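(* Let $q$ be a power of a prime $p$, let $n\geq 2$, and let $X=\{F=0\}\subset\mathbb{P}^n$ be a smooth Frobenius nonclassical hypersurface over $\mathbb{F}_q$ of degree $d\geq 2$. Then $d\leq q+2$, and moreover: (1) $d=q+1$ and $n$ is odd if and only if there exists a nondegenerate skew-symmetric $(n+1)\times(n+1)$ matrix $(A_{ij})$ with entries in $\mathbb{F}_q$ and zero diagonal such that $F=\sum_{i,j=0}^n x_i^qA_{ij}x_j$. (2) $d=q+1$ and $n$ is even if and only if $p=2$ and, up to the action of $\mathrm{PGL}_{n+1}(\mathbb{F}_q)$ on coordinates, $F_{1,0}=x_0^{q-1}F$ and $F=x_0G+\sum_{i,j=1}^n x_i^qB_{ij}x_j$, where $G$ is a polynomial with $\frac{\partial G}{\partial x_0}=0$ and $(B_{ij})_{1\leq i,j\leq n}$ is a nondegenerate skew-symmetric matrix with entries in $\mathbb{F}_q$ and zero diagonal. (3) $d=q+2$ if and only if $p=n=2$ and, after rescaling $F$ by a nonzero constant, $F=x_0x_1x_2(x_0^{q-1}+x_1^{q-1}+x_2^{q-1})+G(x_0^2,x_1^2,x_2^2)$ for some polynomial $G$. Furthermore, condition (1) or condition (3) occurs if and only if $F_{1,0}$ is the zero polynomial.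
   Context: A hypersurface $X=\{F=0\}\subset\mathbb{P}^n$ over $\mathbb{F}_q$ is given by a nonzero homogeneous polynomial $F\in\mathbb{F}_q[x_0,\dots,x_n]$. Define $F_{1,0}:=\sum_{i=0}^n x_i^q\frac{\partial F}{\partial x_i}$. $X$ is called Frobenius nonclassical (over $\mathbb{F}_q$) if $F$ divides $F_{1,0}$; equivalently, the $q$-th Frobenius map sends every $\overline{\mathbb{F}_q}$-point $P\in X$ into the embedded tangent space $T_PX$. *)

(* Defs.v *)
From HB Require Import structures.
From mathcomp Require Import all_boot all_order all_algebra.
From mathcomp Require Import mpoly.
Set Implicit Arguments. Unset Strict Implicit. Unset Printing Implicit Defensive.
Import GRing.Theory.
Local Open Scope ring_scope.

Definition frob10 (K : fieldType) (n q : nat) (F : {mpoly K[n]}) : {mpoly K[n]} :=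
  \sum_(i < n) 'X_i ^+ q * F^`M(i).

Definition frobenius_nonclassical (K : fieldType) (n q : nat) (F : {mpoly K[n]}) : Prop :=
  exists H : {mpoly K[n]}, frob10 q F = H * F.

Definition smooth_hypersurface (K : fieldType) (n : nat) (F : {mpoly K[n]}) : Prop :=
  forall (L : closedFieldType) (iota : {rmorphism K -> L}) (x : 'I_n -> L),
    (exists i, x i != 0) ->
    ~ ((map_mpoly iota F).@[x] = 0 /\
       forall i : 'I_n, (map_mpoly iota (F^`M(i))).@[x] = 0).

Definition skew_zero_diag (K : fieldType) (m : nat) (A : 'M[K]_m) : Prop :=
  A^T = - A /\ forall i, A i i = 0.

Definition frob_form (K : fieldType) (m q : nat) (A : 'M[K]_m) : {mpoly K[m]} :=
  \sum_(i < m) \sum_(j < m) 'X_i ^+ q * (A i j)%:MP * 'X_j.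

Definition frob_form_tail (K : fieldType) (n q : nat) (B : 'M[K]_n) : {mpoly K[n.+1]} :=
  \sum_(i < n) \sum_(j < n)
     'X_(lift ord0 i) ^+ q * (B i j)%:MP * 'X_(lift ord0 j).

Definition lin_subst (K : fieldType) (m : nat) (M : 'M[K]_m) (F : {mpoly K[m]}) : {mpoly K[m]} :=
  F \mPo [tuple \sum_(j < m) (M i j)%:MP * 'X_j | i < m].

Definition sq_subst (K : fieldType) (m : nat) (G : {mpoly K[m]}) : {mpoly K[m]} :=
  G \mPo [tuple 'X_i ^+ 2 | i < m].

(* Main.v *)
Require Import Defs.
From HB Require Import structures.
From Stdlib Require Import ClassicalEpsilon.
From mathcomp Require Import all_boot all_order all_algebra all_solvable all_field.
From mathcomp Require Import zify ring mpoly.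
Set Implicit Arguments. Unset Strict Implicit. Unset Printing Implicit Defensive.
Import GRing.Theory.
Local Open Scope ring_scope.

(** Write F_i for the partial derivatives, H for the quotient F_{1,0} / F.

Smoothness makes the ideal (F, F_0, ..., F_n) contain a power of every
variable, so by depth sensitivity the Koszul homology of a family of m
generators of such an ideal vanishes above degree m - (n + 1).

If p does not divide d, Euler's formula puts F in the ideal of the F_i and
turns F | F_{1,0} into the syzygy x_i^q - (H/d) x_i of the F_i.  It is a
Koszul syzygy sum_l A_il F_l with A alternating of degree q + 1 - d, whence
d <= q + 1.  For d = q + 1 the matrix A is constant.  If A is invertible, then
n is odd and solving for the F_i gives F = sum x_i^q B_ij x_j.  A kernel vector
of A gives a linear form l over F_q with l^q = H l, so H = l^(q-1); in
coordinates with l = x_0, comparing mixed partials forces 2 = 0.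

If p divides d, then sum x_i F_i = 0 and the minors x_i x_j^q - x_j x_i^q
complete to a 2-cycle on the n + 2 generators F, F_0, ..., F_n.  It is a
boundary, so d <= q + 2, and for d = q + 2 the n (n + 1) / 2 independent minors
lie in the span of the n + 1 partials: n = 2 and the F_i are the minors up to
a constant. *)

(** * Closed points of proper ideals *)

Definition ideal_pred (R : comNzRingType) (J : R -> Prop) : Prop :=
  [/\ J 0, forall x y, J x -> J y -> J (x + y) & forall a x, J x -> J (a * x)].

Section MaximalIdeal.

Local Open Scope quotient_scope.

Variables (R : comNzRingType) (T : countType) (enc : R -> T) (dec : T -> R).
Hypothesis encK : cancel enc dec.
Variable J0 : R -> Prop.
Hypotheses (J0_ideal : ideal_pred J0) (J0_proper : ~ J0 1).

Definition adjoin (J : R -> Prop) (r x : R) : Prop :=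
  exists a b, J a /\ x = a + b * r.

Lemma adjoin_ideal J r : ideal_pred J -> ideal_pred (adjoin J r).
Proof.
move=> [J_0 JD JM]; split=> [|x y [a [b [Ja ->]]] [c [e [Jc ->]]]|c x [a [b [Ja ->]]]].
- by exists 0, 0; split => //; rewrite mul0r addr0.
- by exists (a + c), (b + e); split; [exact: JD|rewrite mulrDl addrACA].
- by exists (c * a), (c * b); split; [exact: JM|rewrite mulrDr mulrA].
Qed.

Fixpoint max_chain k : R -> Prop :=
  if k is k'.+1 then
    if unpickle k' is Some t then
      fun x => max_chain k' x
               \/ (~ adjoin (max_chain k') (dec t) 1 /\ adjoin (max_chain k') (dec t) x)
    else max_chain k'
  else J0.

Definition max_ideal (x : R) : Prop := exists k, max_chain k x.

Lemma max_chainP k : ideal_pred (max_chain k) /\ ~ max_chain k 1.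
Proof.
elim: k => [//|k [IHi IHp]] /=; case: unpickle => [t|//].
have [J_0 JD JM] := IHi.
have Asub x : max_chain k x -> adjoin (max_chain k) (dec t) x.
  by move=> Jx; exists x, 0; rewrite mul0r addr0.
have [A0 AD AM] := adjoin_ideal (dec t) IHi.
split; last by case=> [//|[]].
split; first by left.
- move=> x y [Jx|[A1 Ax]] [Jy|[A1' Ay]]; [by left; apply: JD|..];
    by right; split=> //; apply: AD => //; apply: Asub.
- by move=> a x [Jx|[A1 Ax]]; [left; apply: JM|right; split=> //; apply: AM].
Qed.

Lemma max_chain_homo k l x : (k <= l)%N -> max_chain k x -> max_chain l x.
Proof.
move/subnKC <-; elim: (l - k)%N => [|j IHj] Jx; first by rewrite addn0.
by rewrite addnS /=; case: unpickle => [t|]; [left|]; exact: IHj.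
Qed.

Lemma max_idealP : ideal_pred max_ideal.
Proof.
split.
- by exists 0%N; case: J0_ideal.
- move=> x y [k Jx] [l Jy]; exists (maxn k l).
  have [[_ JD _] _] := max_chainP (maxn k l).
  by apply: JD; [apply: max_chain_homo Jx|apply: max_chain_homo Jy];
    rewrite ?leq_maxl ?leq_maxr.
- move=> a x [k Jx]; exists k; have [[_ _ JM] _] := max_chainP k; exact: JM.
Qed.

Lemma max_ideal_proper : ~ max_ideal 1.
Proof. by case=> k; case: (max_chainP k). Qed.

Lemma max_ideal_sub x : J0 x -> max_ideal x.
Proof. by move=> Jx; exists 0%N. Qed.

Lemma max_ideal_inv r : ~ max_ideal r -> exists s, max_ideal (1 - s * r).
Proof.
move=> Mr; pose k := pickle (enc r).
have [[J_0 _ _] _] := max_chainP k.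
case: (excluded_middle_informative (adjoin (max_chain k) r 1)) => [[a [s [Ja e]]]|nA].
  by exists s; exists k; rewrite e addrK.
case: Mr; exists k.+1; rewrite /= pickleK encK; right; split=> //.
by exists 0, 1; split => //; rewrite mul1r add0r.
Qed.

Definition max_mem : pred R := fun x => excluded_middle_informative (max_ideal x).

Lemma max_memP x : reflect (max_ideal x) (x \in max_mem).
Proof. by rewrite unfold_in /max_mem; case: excluded_middle_informative => H; constructor. Qed.

Lemma max_mem_idealr : idealr_closed max_mem.
Proof.
have [M0 MD MM] := max_idealP; split.
- exact/max_memP.
- by apply/max_memP; exact: max_ideal_proper.
- by move=> a x y /max_memP Mx /max_memP My; apply/max_memP/MD => //; exact: MM.
Qed.

Lemma closed_point : exists (L : closedFieldType) (phi : {rmorphism R -> L}),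
  forall x, J0 x -> phi x = 0.
Proof.
pose I : idealr R := HB.pack max_mem (isIdealr.Build R max_mem max_mem_idealr).
pose Q : comNzRingType := {ideal_quot I}.
pose pi : {rmorphism R -> Q} := \pi_({ideal_quot I}).
have pi0 x : (pi x == 0) = (x \in max_mem).
  by rewrite -[0](rmorph0 pi) -[X in _ = X](congr1 (fun y => y \in max_mem) (subr0 x))
    (Quotient.idealrBE I).
have piK (u : Q) : exists r, pi r = u by exists (repr u); exact: reprK.
have invP (u : Q) : exists v, (u != 0) ==> (v * u == 1).
  have [r <-] := piK u; rewrite pi0.
  case: max_memP => [_|/max_ideal_inv [s]]; first by exists 0.
  by move=> /max_memP; rewrite -pi0 rmorphB rmorph1 rmorphM subr_eq0 eq_sym; exists (pi s).
have [ch chP] : exists ch : Q -> Q, forall u, u != 0 -> ch u * u = 1.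
  by exists (fun u => xchoose (invP u)) => u u0; apply/eqP/(implyP (xchooseP (invP u))).
pose inv u := if u == 0 then 0 else ch u.
have mulVq : forall u, u != 0 -> inv u * u = 1.
  by move=> u u0; rewrite /inv (negPf u0) chP.
have inv0 : inv 0 = 0 by rewrite /inv eqxx.
have encQ : cancel (fun u : Q => enc (repr (u : {ideal_quot I}))) (fun t => pi (dec t)).
  by move=> u; rewrite encK; exact: reprK.
pose F : countFieldType := HB.pack Q
  (Countable.copy Q (can_type encQ))
  (GRing.ComNzRing_isField.Build Q mulVq inv0).
have [L [f _]] := countable_algebraic_closure F.
exists L, (f \o (pi : {rmorphism R -> F})) => x /max_ideal_sub/max_memP.
by rewrite -pi0 => /eqP /= ->; rewrite rmorph0.
Qed.

End MaximalIdeal.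

(** * Koszul homology *)

Lemma sum_alternating (V : zmodType) (I : finType) (S : I -> I -> V) :
  (forall i, S i i = 0) -> (forall i j, S i j = - S j i) -> \sum_i \sum_j S i j = 0.
Proof.
move=> S0 SN; rewrite pair_big /=.
rewrite (bigID (fun p : I * I => (enum_rank p.1 < enum_rank p.2)%N)) /=.
rewrite [X in _ + X](bigID (fun p : I * I => p.1 == p.2)) /=.
rewrite [X in _ + (X + _)]big1 ?add0r; last first.
  by move=> [i j] /= /andP[_ /eqP ->]; rewrite S0.
rewrite [X in _ + X](reindex_inj (h := fun p : I * I => (p.2, p.1))) /=; last first.
  by move=> [i j] [k l] [-> ->].
rewrite [X in _ + X](eq_bigl (fun p : I * I => (enum_rank p.1 < enum_rank p.2)%N)); last first.
  move=> [i j] /=; rewrite -leqNgt andbC ltn_neqAle eq_sym; congr (~~ _ && _).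
  by apply/eqP/eqP => [-> //|/val_inj/enum_rank_inj].
by rewrite -big_split big1 // => -[i j] _ /=; rewrite SN addNr.
Qed.

Section Koszul.

Variables (R : comNzRingType) (I : finType) (f : I -> R).
Implicit Types (w : seq I -> R) (s : seq I).

Fixpoint alt_upto k w : Prop :=
  if k is k'.+1 then
    [/\ forall i s, w (i :: i :: s) = 0,
        forall i j s, w (i :: j :: s) = - w (j :: i :: s)
      & forall i, alt_upto k' (fun s => w (i :: s))]
  else True.

Definition alternating w := forall k, alt_upto k w.

Definition kos w : seq I -> R := fun s => \sum_i f i * w (i :: s).

Fixpoint wedge (k : I) w s : R :=
  if s is i :: s' then (i == k)%:R * w s' - wedge k (fun t => w (i :: t)) s'
  else 0.

Lemma alternatingS w i : alternating w -> alternating (fun s => w (i :: s)).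
Proof. by move=> aw k; have [_ _ /(_ i)] := aw k.+1. Qed.

Lemma eq_alt_upto k w1 w2 : w1 =1 w2 -> alt_upto k w1 -> alt_upto k w2.
Proof.
elim: k w1 w2 => [//|k IH] w1 w2 e [w0 wN wS].
split=> [i s|i j s|i]; rewrite -?e //.
by apply: IH (wS i) => s; rewrite e.
Qed.

Lemma eq_alternating w1 w2 : w1 =1 w2 -> alternating w1 -> alternating w2.
Proof. by move=> e aw k; apply: eq_alt_upto (aw k). Qed.

Lemma alt_upto_lin k w1 w2 a b : alt_upto k w1 -> alt_upto k w2 ->
  alt_upto k (fun s => a * w1 s + b * w2 s).
Proof.
elim: k w1 w2 => [//|k IH] w1 w2 [w10 w1N w1S] [w20 w2N w2S].
split=> [i s|i j s|i].
- by rewrite w10 w20 !mulr0 addr0.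
- by rewrite w1N w2N !mulrN -opprD.
- exact: (IH _ _ (w1S i) (w2S i)).
Qed.

Lemma alternating_lin w1 w2 a b : alternating w1 -> alternating w2 ->
  alternating (fun s => a * w1 s + b * w2 s).
Proof. by move=> a1 a2 k; apply: alt_upto_lin. Qed.

Lemma alternating0 : alternating (fun _ => 0).
Proof. by elim=> [//|k IH]; split=> // *; rewrite oppr0. Qed.

Lemma alternating_sum (J : Type) (r : seq J) (a : J -> R) (w : J -> seq I -> R) :
  (forall j, alternating (w j)) -> alternating (fun s => \sum_(j <- r) a j * w j s).
Proof.
move=> aw; elim: r => [|j r IH].
  by apply: eq_alternating alternating0 => s; rewrite big_nil.
apply: eq_alternating (alternating_lin (a j) 1 (aw j) IH) => s.
by rewrite big_cons mul1r.
Qed.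

Lemma alternating_comp (rho : R -> R) w : rho 0 = 0 -> {morph rho : x / - x} ->
  alternating w -> alternating (fun s => rho (w s)).
Proof.
move=> rho0 rhoN + k; elim: k w => [//|k IH] w aw.
have [w0 wN _] := aw k.+1; split=> [i s|i j s|i].
- by rewrite w0.
- by rewrite wN rhoN.
- exact: IH (alternatingS i aw).
Qed.

Lemma eq_wedge k w1 w2 : w1 =1 w2 -> wedge k w1 =1 wedge k w2.
Proof.
move=> e s; elim: s w1 w2 e => [//|i s IH] w1 w2 e /=.
by rewrite e (IH _ (fun t => w2 (i :: t))).
Qed.

Lemma wedge0 k s : wedge k (fun _ => 0) s = 0.
Proof. by elim: s => [//|i s IH] /=; rewrite IH mulr0 subr0. Qed.

Lemma wedgeN k w s : wedge k (fun t => - w t) s = - wedge k w s.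
Proof.
by elim: s w => [|i s IH] w /=; rewrite ?oppr0 // IH mulrN opprB opprK addrC.
Qed.

Lemma wedge_sum k (J : finType) (a : J -> R) (w : J -> seq I -> R) s :
  wedge k (fun t => \sum_j a j * w j t) s = \sum_j a j * wedge k (w j) s.
Proof.
elim: s w => [|i s IH] w /=; first by rewrite big1 // => j _; rewrite mulr0.
rewrite (IH (fun j t => w j (i :: t))) mulr_sumr -sumrB; apply: eq_bigr => j _.
by rewrite mulrBr mulrCA.
Qed.

Lemma wedge_alternating k w : alternating w -> alternating (wedge k w).
Proof.
move=> + l; elim: l w => [//|l IH] w aw; have [w0 wN _] := aw 1%N.
split=> [i s|i j s|i] /=.
- by rewrite (@eq_wedge k _ (fun _ => 0)) // wedge0 subr0 subrr.
- rewrite (@eq_wedge k (fun t => w (i :: j :: t)) (fun t => - w (j :: i :: t))) //.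
  by rewrite wedgeN !opprB addrA.
- have := alt_upto_lin (i == k)%:R (-1) (aw l) (IH _ (alternatingS i aw)).
  by apply: eq_alt_upto => s; rewrite mulN1r.
Qed.

Lemma alternating_nonuniq w s : alternating w -> ~~ uniq s -> w s = 0.
Proof.
elim: s w => [//|i s IH] w aw /=; rewrite negb_and negbK => /orP[|nu]; last first.
  exact: (IH _ (alternatingS i aw)).
case/splitPr=> s1 s2; elim: s1 w aw => [|j s1 IHs] w aw /=; have [w0 wN _] := aw 1%N.
  exact: w0.
by rewrite wN (IHs _ (alternatingS j aw)) oppr0.
Qed.

Lemma kos_kos w s : alternating w -> kos (kos w) s = 0.
Proof.
move=> aw; rewrite /kos; have [w0 wN _] := aw 1%N.
under eq_bigr do rewrite mulr_sumr.
apply: sum_alternating => [i|i j]; first by rewrite w0 !mulr0.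
by rewrite wN !mulrN mulrCA.
Qed.

Lemma kos_wedge k w s : kos (wedge k w) s = f k * w s - wedge k (kos w) s.
Proof.
rewrite /kos /= (wedge_sum k f (fun i t => w (i :: t))).
under eq_bigr do rewrite mulrBr; rewrite sumrB; congr (_ - _).
rewrite (bigD1 k) //= eqxx mul1r big1 ?addr0 // => i /negPf ->.
by rewrite mul0r mulr0.
Qed.

Section Depth.

Variables (N : nat) (J : nat -> R -> Prop) (g : nat -> R) (rho : nat -> R -> R).
Hypothesis J0 : forall k, J k 0.
Hypothesis JD : forall k x y, J k x -> J k y -> J k (x + y).
Hypothesis JM : forall k a x, J k x -> J k (a * x).
Hypothesis JS : forall k x, (k < N)%N -> J k x -> J k.+1 x.
Hypothesis Jg : forall k, (k < N)%N -> J k.+1 (g k).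
Hypothesis g_regular : forall k x, (k < N)%N -> J k (g k * x) -> J k x.
Hypothesis rho0 : forall k, rho k 0 = 0.
Hypothesis rhoN : forall k, {morph rho k : x / - x}.
Hypothesis rhoP : forall k x, (k < N)%N -> J k.+1 x -> J k (x - g k * rho k x).
Hypothesis g_in : forall k, (k < N)%N -> exists a, g k = \sum_i a i * f i.

Lemma J_sum k (K : finType) (F : K -> R) : (forall i, J k (F i)) -> J k (\sum_i F i).
Proof. by move=> JF; elim/big_ind: _ => // x y; apply: JD. Qed.

Lemma JB k x y : J k x -> J k y -> J k (x - y).
Proof. by move=> Jx Jy; apply: JD => //; rewrite -mulN1r; apply: JM. Qed.

Lemma wedge_J k l w s : (forall t, size t = (size s).-1 -> J l (w t)) ->
  (0 < size s)%N -> J l (wedge k w s).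
Proof.
elim: s w => [//|i s IH] w Jw _ /=; apply: JB; first by apply/JM/Jw.
by case: s IH Jw => [|j s] IH Jw //; apply: IH => // t st; apply: Jw; rewrite /= st.
Qed.

(* Exactness in degree j over R / J k is deduced from exactness in degree
   j + 1 over R / J k.+1: multiplication by g k, which lies in the ideal of
   the f i, is both injective and zero on homology. *)
Lemma koszul_exact c k j w : (k + c = N)%N -> (#|I| < j + c)%N -> alternating w ->
  (forall s, (size s).+1 = j -> J k (kos w s)) ->
  exists2 th, alternating th & forall s, size s = j -> J k (w s - kos th s).
Proof.
elim: c k j w => [|c IH] k j w kN lt_j aw closed_w.
  exists (fun _ => 0) => [|s sj]; first exact: alternating0.
  rewrite /kos big1 ?subr0 => [|i _]; last by rewrite mulr0.
  rewrite alternating_nonuniq //; apply: contraL lt_j => us.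
  by rewrite -leqNgt addn0 -sj -(card_uniqP us) max_card.
have k_lt : (k < N)%N by rewrite -kN addnS ltnS leq_addr.
have [a ga] := g_in k_lt.
pose eta s := \sum_i a i * wedge i w s.
have a_eta : alternating eta by apply: alternating_sum => i; apply: wedge_alternating.
have kos_eta s : size s = j -> J k (g k * w s - kos eta s).
  move=> sj; have -> : kos eta s = \sum_i a i * kos (wedge i w) s.
    rewrite /kos /eta; under eq_bigr do rewrite mulr_sumr.
    rewrite exchange_big /=; apply: eq_bigr => i _; rewrite mulr_sumr.
    by apply: eq_bigr => l _; rewrite mulrCA.
  rewrite ga mulr_suml -sumrB; apply: J_sum => i.
  rewrite kos_wedge -mulrA -mulrBr opprB addrC subrK; apply: JM.
  case: s sj => [|l s] sj //=; apply: (@wedge_J i k (kos w) (l :: s)) => // t st.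
  by apply: closed_w; rewrite st.
have kos_etaS s : size s = j -> J k.+1 (kos eta s).
  move=> sj; rewrite -[kos eta s](subKr (g k * w s)); apply: JB.
    by rewrite mulrC; apply/JM/Jg.
  exact/JS/kos_eta.
have [||||ze a_ze eta_ze] := IH k.+1 j.+1 eta.
- by rewrite addSnnS.
- by rewrite addSnnS.
- exact: a_eta.
- by move=> s [sj]; apply: kos_etaS.
pose xi s := eta s - kos ze s.
have a_xi : alternating xi.
  apply: eq_alternating (alternating_lin 1 (-1) a_eta (alternating_sum (index_enum I) f
    (fun i => alternatingS i a_ze))).
  by move=> s; rewrite mul1r mulN1r.
exists (fun s => rho k (xi s)) => [|s sj]; first exact: alternating_comp.
apply: (g_regular k_lt); rewrite mulrBr -[g k * w s](subrK (kos eta s)) -addrA.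
apply: JD; first exact: kos_eta.
have -> : kos eta s = kos xi s.
  rewrite -[RHS]addr0 -(kos_kos s a_ze) /kos -big_split; apply: eq_bigr => i _ /=.
  by rewrite /xi /kos -mulrDr subrK.
rewrite /kos mulr_sumr -sumrB; apply: J_sum => i.
by rewrite mulrCA -mulrBr; apply/JM/rhoP => //; apply: eta_ze; rewrite /= sj.
Qed.

End Depth.

End Koszul.

Section MonomialIdeal.

Variables (K : fieldType) (n M : nat).
Implicit Types (p : {mpoly K[n]}) (i : 'I_n).

Definition xdiv i p : {mpoly K[n]} :=
  \sum_(m <- msupp p | (M <= m i)%N) p@_m *: 'X_[m - U_(i) *+ M].

Lemma mnm_mulU i j : (U_(i) *+ M)%MM j = ((i == j) * M)%N.
Proof. by rewrite mulmnE mnm1E. Qed.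

Lemma mcoeff_xdiv i p m : (xdiv i p)@_m = p@_(m + U_(i) *+ M).
Proof.
have eqv (m' : 'X_{1..n}) : ((M <= m' i)%N && (m' - U_(i) *+ M == m)%MM) = (m' == m + U_(i) *+ M)%MM.
  apply/andP/eqP => [[le_M /eqP <-]|->].
    apply/mnmP => j; rewrite mnmDE mnmBE mnm_mulU.
    by case: eqVneq => [<-|_]; rewrite ?mul1n ?mul0n ?subnK ?subn0 ?addn0.
  split; first by rewrite mnmDE mnm_mulU eqxx mul1n leq_addl.
  by apply/eqP/mnmP => j; rewrite mnmBE mnmDE addnK.
rewrite /xdiv raddf_sum /=.
under eq_bigr do rewrite mcoeffZ mcoeffX mulr_natr mulrb.
rewrite -big_mkcondr; under eq_bigl do rewrite eqv.
case: (boolP (m + U_(i) *+ M \in msupp p)%MM) => [m_in|m_out].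
  by rewrite -big_filter (filter_pred1_uniq (msupp_uniq p) m_in) big_seq1.
rewrite (memN_msupp_eq0 m_out) big_seq_cond big1 // => m' /andP[m'_in /eqP e].
by rewrite e (negPf m_out) in m'_in.
Qed.

Definition monideal (k : nat) p : Prop :=
  forall m, p@_m != 0 -> exists2 i : 'I_n, (i < k)%N & (M <= m i)%N.

Lemma monideal_zero p : monideal 0 p -> p = 0.
Proof.
move=> Jp; apply/mpolyP => m; rewrite mcoeff0; apply/eqP; apply: contraT.
by move=> /Jp [].
Qed.

Lemma monidealD k p1 p2 : monideal k p1 -> monideal k p2 -> monideal k (p1 + p2).
Proof.
move=> J1 J2 m; case: (eqVneq p1@_m 0) => [e|/J1 //].
by rewrite mcoeffD e add0r => /J2.
Qed.

Lemma monidealM k a p : monideal k p -> monideal k (a * p).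
Proof.
move=> Jp m; rewrite -mcoeff_msupp => /msuppM_le /allpairsP [[m1 m2] /= [_ + ->]].
rewrite mcoeff_msupp => /Jp [i ik le_M]; exists i => //.
by rewrite mnmDE (leq_trans le_M) // leq_addl.
Qed.

Lemma monideal_regular i p : monideal i ('X_i ^+ M * p) -> monideal i p.
Proof.
move=> Jp m pm; have /Jp : ('X_i ^+ M * p)@_(U_(i) *+ M + m) != 0.
  by rewrite mpolyXn mulrC mcoeffMX.
case=> l li le_M; exists l => //; move: le_M; rewrite mnmDE mnm_mulU.
by case: eqVneq li => [->|]; rewrite ?ltnn.
Qed.

Lemma mcoeff_subxdiv i p m :
  (p - 'X_i ^+ M * xdiv i p)@_m = if (M <= m i)%N then 0 else p@_m.
Proof.
rewrite mcoeffB mpolyXn mulrC; case: leqP => [le_M|lt_M].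
  have -> : m = (U_(i) *+ M + (m - U_(i) *+ M))%MM.
    apply/mnmP => j; rewrite mnmDE mnmBE mnm_mulU.
    by case: eqVneq => [<-|_]; rewrite ?mul1n ?mul0n ?subn0 // addnC subnK.
  by rewrite mcoeffMX mcoeff_xdiv addmC subrr.
rewrite [X in _ - X]memN_msupp_eq0 ?subr0 // (perm_mem (msuppMX _ _)).
apply: contraL lt_M => /mapP [m' _ ->].
by rewrite mnmDE mnm_mulU eqxx mul1n -leqNgt leq_addr.
Qed.

Theorem koszul_mpoly_exact (I : finType) (f : I -> {mpoly K[n]}) (j : nat)
    (w : seq I -> {mpoly K[n]}) :
  (forall i, exists a : I -> {mpoly K[n]}, 'X_i ^+ M = \sum_l a l * f l) ->
  (#|I| < j + n)%N -> alternating w ->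
  (forall s, (size s).+1 = j -> kos f w s = 0) ->
  exists2 th, alternating th & forall s, size s = j -> w s = kos f th s.
Proof.
move=> f_in lt_j aw closed_w.
pose g k : {mpoly K[n]} := if insub k is Some i then 'X_(i : 'I_n) ^+ M else 0.
pose rho k : {mpoly K[n]} -> {mpoly K[n]} := if insub k is Some i then xdiv (i : 'I_n) else id.
have [|||||||||||th a_th th_w] := @koszul_exact _ I f n monideal g rho _ _ _ _ _ _ _ _ _ _
   n 0 j w (add0n n) lt_j aw.
- by move=> k m; rewrite mcoeff0 eqxx.
- exact: monidealD.
- exact: monidealM.
- by move=> k p _ Jp m /Jp [i ik le_M]; exists i => //; apply: ltnW.
- move=> k lt_k m; rewrite /g insubT /= mpolyXn mcoeffX.
  case: (_ =P m) => [<- _|]; last by rewrite eqxx.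
  by exists (Ordinal lt_k); rewrite //= mnm_mulU eqxx mul1n.
- by move=> k p lt_k; rewrite /g insubT /=; apply: (@monideal_regular (Ordinal lt_k)).
- move=> k; rewrite /rho; case: insub => [i|//].
  by apply/mpolyP => m; rewrite mcoeff_xdiv !mcoeff0.
- move=> k; rewrite /rho; case: insub => [i|//] p.
  by apply/mpolyP => m; rewrite mcoeffN !mcoeff_xdiv mcoeffN.
- move=> k p lt_k Jp m; rewrite /rho /g insubT mcoeff_subxdiv /=.
  case: leqP => [_|lt_M /Jp [l]]; first by rewrite eqxx.
  rewrite ltnS leq_eqVlt => /orP[/eqP e|]; last by exists l.
  have -> : l = Ordinal lt_k by apply: val_inj.
  by rewrite leqNgt lt_M.
- by move=> k lt_k; rewrite /g insubT; apply: f_in.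
- by move=> s sj m; rewrite closed_w // mcoeff0 eqxx.
by exists th => // s /th_w /monideal_zero /eqP; rewrite subr_eq0 => /eqP.
Qed.

End MonomialIdeal.

(** * Homogeneous Nullstellensatz *)

Section Homogeneous.

Variables (K : fieldType) (n : nat).
Implicit Types p G : {mpoly K[n]}.

Lemma pihomogM_dhomog r k p G : G \is k.-homog ->
  pihomog mdeg r (p * G) = if (r < k)%N then 0 else pihomog mdeg (r - k) p * G.
Proof.
move=> hG.
have piX m : pihomog mdeg r ('X_[m] * G)
    = if (r < k)%N then 0 else pihomog mdeg (r - k) 'X_[m] * G.
  have hX : 'X_[m] * G \is (mdeg m + k).-homog by rewrite dhomogM // dhomogX.
  rewrite pihomogX; case: (eqVneq (mdeg m + k)%N r) => [e|ne].
    by rewrite -e ltnNge leq_addl addnK eqxx /= pihomog_dE // e.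
  rewrite (pihomog_ne0 ne hX); case: ltnP => // le_k.
  by case: eqP => [e|]; rewrite ?mul0r //; rewrite e subnK ?eqxx in ne.
rewrite [p]mpolyE mulr_suml !raddf_sum /=.
under eq_bigr do rewrite -scalerAl linearZ /= piX.
case: ifP => _; first by rewrite big1 // => m _; rewrite scaler0.
rewrite mulr_suml; apply: eq_bigr => m _; by rewrite linearZ /= -scalerAl.
Qed.

Lemma pihomog_msize r p : (msize p <= r)%N -> pihomog mdeg r p = 0.
Proof.
move=> le_r; rewrite pihomogE big_seq_cond big1 // => m /andP[m_in /eqP e].
by have := msize_mdeg_lt m_in; rewrite e ltnNge le_r.
Qed.

Definition homogenize (i : 'I_n) B p : {mpoly K[n]} :=
  \sum_(e < B.+1) 'X_i ^+ (B - e) * pihomog mdeg e p.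

Lemma homogenizeM i B k p G : G \is k.-homog ->
  exists c, homogenize i B (p * G) = c * G.
Proof.
move=> hG; exists (\sum_(e < B.+1) 'X_i ^+ (B - e) *
  if (e < k)%N then 0 else pihomog mdeg (e - k) p).
rewrite /homogenize mulr_suml; apply: eq_bigr => e _.
by rewrite (pihomogM_dhomog _ _ hG); case: ifP => _; rewrite ?mulr0 ?mul0r // mulrA.
Qed.

Lemma homogenize1 i B : homogenize i B 1 = 'X_i ^+ B.
Proof.
rewrite /homogenize big_ord_recl /= subn0 pihomog_dE ?dhomog1 // mulr1.
rewrite big1 ?addr0 // => e _.
by rewrite (@pihomog_ne0 _ _ _ 0%N) ?mulr0 // dhomog1.
Qed.

Lemma homogenize_subX1 i B p : (msize p <= B)%N -> homogenize i B (p * ('X_i - 1)) = 0.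
Proof.
move=> le_B; have hX : 'X_i \is [in K[n], 1.-homog] by rewrite dhomogX /= mdeg1.
rewrite /homogenize mulrBr mulr1; under eq_bigr do rewrite raddfB /= mulrBr.
rewrite sumrB big_ord_recl /= (pihomogM_dhomog _ _ hX) mulr0 add0r.
rewrite [X in _ - X]big_ord_recr /= (pihomog_msize le_B) mulr0 addr0.
apply/eqP; rewrite subr_eq0; apply/eqP/eq_bigr => e _.
rewrite (pihomogM_dhomog _ _ hX) /= /bump /= add1n subn1 /= mulrCA -exprSr mulrC.
by rewrite -subSn // subSS.
Qed.

Lemma homogenizeD i B p1 p2 :
  homogenize i B (p1 + p2) = homogenize i B p1 + homogenize i B p2.
Proof. by rewrite /homogenize -big_split; apply: eq_bigr => e _; rewrite raddfD mulrDr. Qed.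

Lemma homogenize_sum i B (J : finType) (P : J -> {mpoly K[n]}) :
  homogenize i B (\sum_j P j) = \sum_j homogenize i B (P j).
Proof.
rewrite /homogenize exchange_big; apply: eq_bigr => e _.
by rewrite raddf_sum mulr_sumr.
Qed.

End Homogeneous.

Lemma rmorph_mpolyE (K L : fieldType) n (phi : {rmorphism {mpoly K[n]} -> L}) p :
  (map_mpoly (phi \o (@mpolyC n K)) p).@[fun i => phi 'X_i] = phi p.
Proof.
rewrite [p in RHS]mpolyE /map_mpoly /mmap !raddf_sum /=; apply: eq_bigr => m _.
rewrite mmap1_id mevalM mevalC mevalX -mul_mpolyC rmorphM /=; congr (_ * _).
rewrite [in RHS]mpolyXE_id rmorph_prod; apply: eq_bigr => i _.
by rewrite rmorphXn.
Qed.

Theorem homogeneous_nullstellensatz (K : finFieldType) n (I : finType)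
    (f : I -> {mpoly K[n]}) (deg : I -> nat) :
  (forall l, f l \is (deg l).-homog) ->
  (forall (L : closedFieldType) (iota : {rmorphism K -> L}) (x : 'I_n -> L),
     (exists i, x i != 0) -> ~ forall l, (map_mpoly iota (f l)).@[x] = 0) ->
  exists M, forall i : 'I_n, exists a : I -> {mpoly K[n]}, 'X_i ^+ M = \sum_l a l * f l.
Proof.
move=> hom_f no_zero.
have one_in i : exists M, exists a : I -> {mpoly K[n]}, 'X_i ^+ M = \sum_l a l * f l.
  pose J (x : {mpoly K[n]}) := exists (a : I -> {mpoly K[n]}) c, x = \sum_l a l * f l + c * ('X_i - 1).
  have J_ideal : ideal_pred J.
    split=> [|x y [a [c ->]] [b [e ->]]|b x [a [c ->]]].
    - exists (fun _ => 0), 0; rewrite mul0r addr0 big1 // => l _; by rewrite mul0r.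
    - exists (fun l => a l + b l), (c + e); rewrite mulrDl addrACA -big_split.
      by congr (_ + _); apply: eq_bigr => l _; rewrite mulrDl.
    - exists (fun l => b * a l), (b * c); rewrite mulrDr mulr_sumr mulrA.
      by congr (_ + _); apply: eq_bigr => l _; rewrite mulrA.
  have Jf l : J (f l).
    exists (fun k => (k == l)%:R), 0; rewrite mul0r addr0 (bigD1 l) //= eqxx mul1r.
    by rewrite big1 ?addr0 // => k /negPf ->; rewrite mul0r.
  have JX : J ('X_i - 1).
    by exists (fun _ => 0), 1; rewrite mul1r big1 ?add0r // => l _; rewrite mul0r.
  have [[a [c e1]]|J1] := classic (J 1).
    exists (msize c).
    have /(congr1 (homogenize i (msize c))) := e1.
    rewrite homogenize1 homogenizeD homogenize_sum homogenize_subX1 // addr0.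
    have hom_af l : exists c', homogenize i (msize c) (a l * f l) = c' * f l.
      exact: homogenizeM (hom_f l).
    have [a' a'E] := fin_all_exists hom_af.
    by move=> ->; exists a'; apply: eq_bigr => l _.
  pose enc (p : {mpoly K[n]}) := [seq (m, p@_m) | m <- msupp p].
  pose dec s : {mpoly K[n]} := \sum_(u <- s) u.2 *: 'X_[u.1].
  have encK : cancel enc dec by move=> p; rewrite /dec /enc big_map [RHS]mpolyE.
  have [L [phi phi0]] := closed_point encK J_ideal J1.
  exfalso; apply: (no_zero L (phi \o @mpolyC n K) (fun k => phi 'X_k)).
    exists i; have /phi0/eqP := JX.
    by rewrite rmorphB rmorph1 subr_eq0 => /eqP ->; rewrite oner_eq0.
  by move=> l; rewrite rmorph_mpolyE; apply/phi0/Jf.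
have [M ME] := fin_all_exists one_in.
exists (\sum_i M i)%N => i; have [a aE] := ME i.
exists (fun l => 'X_i ^+ (\sum_(j | j != i) M j) * a l).
rewrite (bigD1 i) //= exprD aE mulrC mulr_sumr; by apply: eq_bigr => l _; rewrite mulrA.
Qed.

(** * Derivatives and linear substitutions *)

Section MpolyFacts.

Variables (K : fieldType) (n : nat).
Implicit Types (F G : {mpoly K[n]}) (M : 'M[K]_n).

Lemma mpoly_ring_ind (P : {mpoly K[n]} -> Prop) :
  (forall c, P c%:MP) -> (forall i, P 'X_i) ->
  (forall F G, P F -> P G -> P (F + G)) -> (forall F G, P F -> P G -> P (F * G)) ->
  forall F, P F.
Proof.
move=> PC PX PD PM F; rewrite [F]mpolyE.
have P0 : P 0 by rewrite -mpolyC0.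
have P1 : P 1 by rewrite -mpolyC1.
apply: (big_ind P) => // m _; rewrite -mul_mpolyC; apply: (PM _ _ (PC _)).
rewrite mpolyXE_id; apply: (big_ind P) => // i _.
by elim: (m i) => [|k IH]; rewrite ?expr0 // exprS; apply: PM.
Qed.

Lemma mpolyX_eq0 (m : 'X_{1..n}) : ('X_[m] == 0 :> {mpoly K[n]}) = false.
Proof. by rewrite -msupp_eq0 msuppX. Qed.

Lemma mderivXU i j : ('X_i : {mpoly K[n]})^`M(j) = (i == j)%:R.
Proof.
rewrite mderivX mnm1E; case: eqP => [->|_]; last by rewrite scale0r.
by rewrite scale1r (_ : _ - _ = 0)%MM ?mpolyX0 //; apply/mnmP => k; rewrite mnmBE subnn mnm0E.
Qed.

Lemma euler_homog d F : F \is d.-homog -> \sum_i 'X_i * F^`M(i) = d%:R *: F.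
Proof.
move=> hF; rewrite [F in RHS]mpolyE scaler_sumr.
have dE i : F^`M(i) = \sum_(m <- msupp F) F@_m *: 'X_[m]^`M(i).
  by rewrite [in LHS](mpolyE F) raddf_sum; apply: eq_bigr => m _; rewrite /= mderivZ.
under eq_bigr do rewrite dE mulr_sumr.
rewrite exchange_big /= big_seq [RHS]big_seq; apply: eq_bigr => m m_in.
rewrite -(dhomog_mf hF m_in) /= mdegE natr_sum scaler_suml; apply: eq_bigr => i _.
rewrite mderivX -!scalerAr scalerA mulrC -scalerA.
have [->|mi] := posnP (m i); first by rewrite mulr0n !scale0r.
congr (_ *: (_ *: _)); rewrite -mpolyXD; congr ('X_[_]).
apply/mnmP => j; rewrite mnmDE mnmBE mnm1E; case: eqVneq => [<-|_].
  by rewrite add1n subn1 prednK.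
by rewrite add0n subn0.
Qed.

Lemma mderiv_homog d i F : F \is d.-homog -> F^`M(i) \is d.-1.-homog.
Proof.
move=> hF; apply/dhomogP => m; rewrite mcoeff_msupp mcoeff_deriv => Fm.
have : (m + U_(i))%MM \in msupp F.
  by rewrite mcoeff_msupp; apply: contraNneq Fm => ->; rewrite mul0rn.
by move/(dhomog_mf hF) <-; rewrite /= mdegD mdeg1 addn1.
Qed.

Lemma pihomog0E F : pihomog mdeg 0 F = (F@_0)%:MP.
Proof.
rewrite [F in LHS]mpolyE raddf_sum /=.
under eq_bigr do rewrite linearZ /= pihomogX mdeg_eq0.
case: (boolP (0%MM \in msupp F)) => [in0|/memN_msupp_eq0 e].
  rewrite (bigD1_seq 0%MM) ?msupp_uniq //= eqxx big1 ?addr0 => [|m /negPf ->]; last first.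
    by rewrite scaler0.
  by rewrite mpolyX0 -mul_mpolyC mulr1.
rewrite e mpolyC0 big1 // => m _; case: eqP => [->|_]; last by rewrite scaler0.
by rewrite e scale0r.
Qed.

Lemma homog_comb (I : finType) (f a : I -> {mpoly K[n]}) (deg : I -> nat) r G :
  G \is r.-homog -> (forall l, f l \is (deg l).-homog) -> (forall l, r <= deg l)%N ->
  G = \sum_l a l * f l -> G = \sum_(l | deg l == r) (a l)@_0 *: f l.
Proof.
move=> hG hf le_r e; rewrite -(pihomog_dE hG) e raddf_sum [RHS]big_mkcond.
apply: eq_bigr => l _ /=; rewrite (pihomogM_dhomog _ _ (hf l)).
have := le_r l; case: ltngtP => // <- _.
by rewrite subnn pihomog0E mul_mpolyC.
Qed.

Lemma dhomog_bigprod (f : 'I_n -> {mpoly K[n]}) (k : 'I_n -> nat) :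
  (forall i, f i \is (k i).-homog) -> \prod_i f i \is (\sum_i k i)%N.-homog.
Proof.
by move=> hf; elim/big_rec2: _ => [|i d p _ hp]; [exact: dhomog1|exact: dhomogM].
Qed.

Lemma dhomogXU i : 'X_i \is [in K[n], 1.-homog].
Proof. by rewrite dhomogX /= mdeg1. Qed.

Lemma lin_substX M i : lin_subst M 'X_i = \sum_j M i j *: 'X_j.
Proof.
rewrite /lin_subst comp_mpolyXU -tnth_nth tnth_mktuple.
by apply: eq_bigr => j _; rewrite mul_mpolyC.
Qed.

HB.instance Definition _ M :=
  GRing.RMorphism.copy (@lin_subst K n M)
    (comp_mpoly [tuple \sum_(j < n) (M i j)%:MP * 'X_j | i < n]).

Lemma lin_substC M c : lin_subst M c%:MP = c%:MP.
Proof. exact: comp_mpolyC. Qed.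

Lemma lin_substZ M c F : lin_subst M (c *: F) = c *: lin_subst M F.
Proof. exact: comp_mpolyZ. Qed.

Lemma lin_subst_comp M M' F : lin_subst M' (lin_subst M F) = lin_subst (M *m M') F.
Proof.
elim/mpoly_ring_ind: F => [c|i|F G IF IG|F G IF IG].
- by rewrite !lin_substC.
- rewrite !lin_substX rmorph_sum /=.
  under eq_bigr do rewrite lin_substZ lin_substX scaler_sumr.
  rewrite exchange_big; apply: eq_bigr => j _; rewrite mxE scaler_suml.
  by apply: eq_bigr => k _; rewrite scalerA.
- by rewrite !rmorphD /= IF IG.
- by rewrite !rmorphM /= IF IG.
Qed.

Lemma lin_subst1 F : lin_subst 1%:M F = F.
Proof.
elim/mpoly_ring_ind: F => [c|i|F G IF IG|F G IF IG].
- by rewrite !lin_substC.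
- rewrite lin_substX (bigD1 i) //= mxE eqxx scale1r big1 ?addr0 // => j ne.
  by rewrite mxE eq_sym (negPf ne) scale0r.
- by rewrite !rmorphD /= IF IG.
- by rewrite !rmorphM /= IF IG.
Qed.

Lemma lin_subst_homog d M F : F \is d.-homog -> lin_subst M F \is d.-homog.
Proof.
move=> hF; rewrite [F]mpolyE rmorph_sum /= big_seq; apply: rpred_sum => m m_in.
rewrite lin_substZ; apply: rpredZ.
rewrite /lin_subst comp_mpolyX -(dhomog_mf hF m_in) /= mdegE.
apply: dhomog_bigprod => i; rewrite -[X in X.-homog]mul1n; apply: dhomogMn.
rewrite tnth_mktuple; apply: rpred_sum => j _; rewrite mul_mpolyC; apply: rpredZ.
exact: dhomogXU.
Qed.

Lemma mderiv_lin_subst M F j :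
  (lin_subst M F)^`M(j) = \sum_i M i j *: lin_subst M F^`M(i).
Proof.
elim/mpoly_ring_ind: F => [c|i|F G IF IG|F G IF IG].
- by rewrite lin_substC mderivC big1 // => i _; rewrite mderivC rmorph0 scaler0.
- rewrite lin_substX raddf_sum /=.
  under eq_bigr do rewrite linearZ /= mderivXU.
  under [RHS]eq_bigr do rewrite mderivXU.
  rewrite (bigD1 j) //= eqxx big1 ?addr0 => [|k /negPf ->]; last by rewrite scaler0.
  rewrite (bigD1 i) //= eqxx big1 ?addr0 => [|k ne]; last first.
    by rewrite eq_sym (negPf ne) rmorph0 scaler0.
  by rewrite rmorph_nat.
- rewrite !rmorphD /= raddfD /= IF IG -big_split; apply: eq_bigr => i _.
  by rewrite raddfD rmorphD /= scalerDr.
- rewrite !rmorphM /= mderivM IF IG mulr_suml mulr_sumr -big_split; apply: eq_bigr => i _.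
  by rewrite mderivM rmorphD !rmorphM /= scalerDr scalerAl scalerAr.
Qed.

Lemma meval_lin_subst (L : fieldType) (iota : {rmorphism K -> L}) M F (x : 'I_n -> L) :
  (map_mpoly iota (lin_subst M F)).@[x]
  = (map_mpoly iota F).@[fun i => \sum_j iota (M i j) * x j].
Proof.
elim/mpoly_ring_ind: F => [c|i|F G IF IG|F G IF IG].
- by rewrite lin_substC map_mpolyC !mevalC.
  rewrite lin_substX map_mpolyX mevalXU (raddf_sum (map_mpoly iota)) raddf_sum /=.
  by apply: eq_bigr => j _; rewrite map_mpolyZ map_mpolyX mevalZ mevalXU.
- by rewrite !rmorphD /= IF IG.
- by rewrite !rmorphM /= IF IG.
Qed.

Lemma smooth_lin_subst M F : M \in unitmx ->
  smooth_hypersurface F -> smooth_hypersurface (lin_subst M F).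
Proof.
move=> uM smF L iota x [i0 x0] [Fx dFx].
pose y i := \sum_j iota (M i j) * x j.
have Miota : map_mx iota (invmx M) *m map_mx iota M = 1%:M.
  by rewrite -map_mxM mulVmx // map_mx1.
apply: (smF L iota y).
  apply/existsP; apply: contraNT x0; rewrite negb_exists => /forallP y0.
  have : \col_i y i = map_mx iota M *m \col_i x i.
    by apply/colP => i; rewrite !mxE; apply: eq_bigr => j _; rewrite !mxE.
  move/(congr1 (mulmx (map_mx iota (invmx M)))); rewrite mulmxA Miota mul1mx.
  move/colP/(_ i0); rewrite !mxE => <-; rewrite big1 // => j _.
  by have := y0 j; rewrite negbK !mxE => /eqP ->; rewrite mulr0.
split; first by rewrite -meval_lin_subst.
pose dF := \row_i (map_mpoly iota F^`M(i)).@[y].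
have dF0 : dF *m map_mx iota M = 0.
  apply/rowP => j; rewrite !mxE -[RHS](dFx j) mderiv_lin_subst (raddf_sum (map_mpoly iota)) raddf_sum /=.
  by apply: eq_bigr => i _; rewrite !mxE map_mpolyZ mevalZ meval_lin_subst mulrC.
have : dF = 0 by rewrite -[dF]mulmx1 -(map_mx1 iota) -(mulmxV uM) map_mxM mulmxA dF0 mul0mx.
by move=> /rowP dF_0 i; have := dF_0 i; rewrite !mxE.
Qed.

End MpolyFacts.

(** * Alternating matrices *)

Section AlternatingMatrices.

Variable K : fieldType.

Lemma skew_zero_diagN m (A : 'M[K]_m) i j : skew_zero_diag A -> A i j = - A j i.
Proof. by move=> [AT _]; have /matrixP/(_ j i) := AT; rewrite !mxE. Qed.

Lemma skew_congr m k (A : 'M[K]_m) (P : 'M[K]_(k, m)) :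
  skew_zero_diag A -> skew_zero_diag (P *m A *m P^T).
Proof.
move=> hA; have [AT A0] := hA; split=> [|i].
  by rewrite !trmx_mul trmxK AT mulNmx mulmxN mulmxA.
rewrite mxE; under eq_bigr do rewrite !mxE mulr_suml.
apply: (@sum_alternating K _ (fun j l => P i l * A l j * P i j)) => [j|j l].
  by rewrite A0 mulr0 mul0r.
by rewrite (skew_zero_diagN l j hA) mulrN mulNr mulrC mulrA mulrAC.
Qed.

Lemma skew_opp m (A : 'M[K]_m) : skew_zero_diag A -> skew_zero_diag (- A).
Proof. by move=> [AT A0]; split=> [|i]; rewrite ?raddfN /= ?AT // mxE A0 oppr0. Qed.

Lemma skew_tr m (A : 'M[K]_m) : skew_zero_diag A -> skew_zero_diag A^T.
Proof. by move=> hA; have [-> _] := hA; apply: skew_opp. Qed.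

Lemma skew_inv m (A : 'M[K]_m) :
  A \in unitmx -> skew_zero_diag A -> skew_zero_diag (invmx A).
Proof.
move=> uA hA; have [AT _] := hA.
have -> : invmx A = - (invmx A *m A *m (invmx A)^T); last exact/skew_opp/skew_congr.
rewrite mulVmx // mul1mx trmx_inv AT.
apply: (can_inj (mulKmx uA)); rewrite mulmxV //.
by rewrite mulmxN -mulNmx mulmxV // unitmxE -scaleN1r detZ unitrM -unitmxE uA unitrX ?unitrN1.
Qed.

(* In characteristic 2 the sign argument says nothing, so A is specialised
   from the generic alternating matrix over the integers. *)
Lemma det_skew_odd m (A : 'M[K]_m) : skew_zero_diag A -> odd m -> \det A = 0.
Proof.
move=> hA m_odd; have [_ A0] := hA.
pose U : 'M[{mpoly int[m * m]}]_m :=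
  \matrix_(i, j) (if (i < j)%N then 'X_(mxvec_index i j) else 0).
have detS : \det (U - U^T) = 0.
  have /eqP : \det (U - U^T) = - \det (U - U^T).
    rewrite -[LHS]det_tr raddfB /= trmxK -opprB -scaleN1r detZ.
    by rewrite -signr_odd m_odd mulN1r.
  rewrite -subr_eq0 opprK -mulr2n -scaler_nat mscalerI.
  by case/orP => /eqP.
pose phi : {rmorphism {mpoly int[m * m]} -> K} := mmap intr (fun k => mxvec A 0 k).
have phiX i j : phi 'X_(mxvec_index i j) = A i j.
  by rewrite /phi /= mmapX mmap1U mxvecE.
have -> : A = map_mx phi (U - U^T).
  apply/matrixP => i j; rewrite !mxE rmorphB /=.
  case: (ltngtP i j) => [lt|lt|/val_inj ->]; rewrite ?phiX ?rmorph0 ?subr0 ?sub0r //.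
    by rewrite -skew_zero_diagN.
by rewrite det_map_mx detS rmorph0.
Qed.

Lemma singular_row m (A : 'M[K]_m) : A \notin unitmx ->
  exists2 v : 'rV_m, v != 0 & v *m A = 0.
Proof.
rewrite -row_free_unit -kermx_eq0 => /rowV0Pn [v /sub_kermxP vA v0].
by exists v.
Qed.

Lemma row_to_first m (v : 'rV[K]_m.+1) : v != 0 ->
  exists2 M : 'M[K]_m.+1, M \in unitmx & v *m M = delta_mx 0 0.
Proof.
move=> v0; have := mulmx_ebase v; rewrite (rank_rV v) v0.
have u1 := col_ebase_unit v; have u2 := row_ebase_unit v.
move: u1 u2; move: (col_ebase v) (row_ebase v) => c U u1 u2 <-.
have c0 : c 0 0 != 0 by move: u1; rewrite unitmxE [c]mx11_scalar det_scalar1 unitfE mxE.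
exists ((c 0 0)^-1 *: invmx U).
  by rewrite unitmxE detZ unitrM unitrX ?unitrV ?unitfE //= -unitfE -unitmxE unitmx_inv.
rewrite -scalemxAr mulmxK // [c]mx11_scalar mul_scalar_mx scalerA mxE eqxx mulr1n mulVf //.
rewrite scale1r; apply/rowP => j; rewrite !mxE; by case: j => [[|j] ?].
Qed.

End AlternatingMatrices.

(** * Syzygies and Frobenius forms *)

Section LowSyzygies.

Variables (K : fieldType) (n M : nat) (I : finType) (f : I -> {mpoly K[n]}).
Hypothesis f_in : forall i, exists a : I -> {mpoly K[n]}, 'X_i ^+ M = \sum_l a l * f l.

Lemma syzygy1 (c : I -> {mpoly K[n]}) : (#|I| <= n)%N -> \sum_i c i * f i = 0 ->
  exists A : I -> I -> {mpoly K[n]},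
    [/\ forall i, A i i = 0, forall i j, A i j = - A j i
      & forall i, c i = \sum_l A i l * f l].
Proof.
move=> le_n c0.
pose w s := if s is [:: i] then c i else 0.
have aw : alternating w.
  case=> [//|k]; split=> [//|i j s|i]; first by rewrite oppr0.
  case: k => [//|k]; split=> [//|j l s|j]; first by rewrite oppr0.
  exact: alternating0.
have [|s [/size0nil ->]|th ath th_w] := koszul_mpoly_exact f_in (j := 1%N) _ aw.
- by rewrite add1n ltnS.
- by rewrite -[RHS]c0; apply: eq_bigr => i _; rewrite mulrC.
have [th0 thN _] := ath 1%N.
exists (fun i l => th [:: l; i]); split=> // i.
by rewrite -[c i]/(w [:: i]) (th_w [:: i] erefl) /kos; apply: eq_bigr => l _; rewrite mulrC.
Qed.

Lemma syzygy2 (W : I -> I -> {mpoly K[n]}) : (#|I| <= n.+1)%N ->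
  (forall i, W i i = 0) -> (forall i j, W i j = - W j i) ->
  (forall j, \sum_i W i j * f i = 0) ->
  exists T : I -> I -> I -> {mpoly K[n]},
    [/\ forall l i, T l i i = 0, forall l i j, T l i j = - T l j i,
        forall l i j, T l i j = - T i l j, forall i j, T i i j = 0
      & forall i j, W i j = \sum_l T l i j * f l].
Proof.
move=> le_n W0 WN closedW.
pose w s := if s is [:: i; j] then W i j else 0.
have aw : alternating w.
  case=> [//|k]; split=> [i s|i j s|i].
  - by case: s => [|? ?] /=; rewrite ?W0.
  - by case: s => [|? ?] /=; rewrite ?oppr0 // WN.
  case: k => [//|k]; split=> [//|j l s|j]; first by rewrite oppr0.
  case: k => [//|k]; split=> [//|l l' s|l]; first by rewrite oppr0.
  exact: alternating0.
have [||th ath th_w] := koszul_mpoly_exact f_in (j := 2) _ aw.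
- by rewrite addSn add1n ltnS.
- case=> [//|j [|//]] _; rewrite -[RHS](closedW j).
  by apply: eq_bigr => i _; rewrite mulrC.
have [th0 thN _] := ath 1%N; have thS i := alternatingS i ath 1%N.
exists (fun l i j => th [:: l; i; j]); split=> //.
- by move=> l i; have [] := thS l.
- by move=> l i j; have [] := thS l.
by move=> i j; rewrite -[W i j]/(w [:: i; j]) (th_w [:: i; j] erefl) /kos; apply: eq_bigr => l _; rewrite mulrC.
Qed.

End LowSyzygies.

Section FrobeniusForms.

Variable K : finFieldType.
Local Notation q := #|K|.

Lemma card_gt1 : (1 < q)%N. Proof. exact: finNzRing_gt1. Qed.

Variable n : nat.
Implicit Types (F G : {mpoly K[n]}) (i j k l : 'I_n).

Lemma eq_frob_mon i j k l :
  ((U_(i) *+ q + U_(j) == U_(k) *+ q + U_(l))%MM) = (i == k) && (j == l).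
Proof.
apply/eqP/andP => [/mnmP e|[/eqP -> /eqP ->] //].
have q1 := card_gt1.
have ik : i = k.
  have := e i; rewrite !mnmDE !mulmnE !mnm1E eqxx.
  case: (eqVneq k i) => [-> //|_]; rewrite mul1n mul0n add0n.
  by move: q1; move: #|K| => r q1; case: (l == i); case: (j == i) => /=; lia.
split; first by rewrite ik.
have := e j; rewrite !mnmDE !mulmnE !mnm1E ik eqxx => /addnI.
by case: (eqVneq l j).
Qed.

Lemma mcoeff_frob_mon i j k l :
  ('X_i ^+ q * 'X_j : {mpoly K[n]})@_(U_(k) *+ q + U_(l)) = ((i == k) && (j == l))%:R.
Proof. by rewrite mpolyXn -mpolyXD mcoeffX eq_frob_mon. Qed.

Lemma frob_formE (A : 'M[K]_n) :
  frob_form q A = \sum_i \sum_j A i j *: ('X_i ^+ q * 'X_j).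
Proof.
apply: eq_bigr => i _; apply: eq_bigr => j _.
by rewrite mulrAC mulrC mul_mpolyC.
Qed.

Lemma frob_form_homog (A : 'M[K]_n) : frob_form q A \is q.+1.-homog.
Proof.
rewrite frob_formE; apply: rpred_sum => i _; apply: rpred_sum => j _; apply: rpredZ.
by rewrite mpolyXn -mpolyXD dhomogX /= mdegD mdegMn !mdeg1 mul1n addn1.
Qed.

Lemma sum_skew m (A : 'M[K]_m) (x : 'I_m -> {mpoly K[n]}) : skew_zero_diag A ->
  \sum_i \sum_j A i j *: (x i * x j) = 0.
Proof.
move=> hA; have [_ A0] := hA.
apply: sum_alternating => [i|i j]; first by rewrite A0 scale0r.
by rewrite (skew_zero_diagN i j hA) scaleNr mulrC.
Qed.

Lemma skew_contract m (B : 'M[K]_m) (x : 'I_m -> {mpoly K[n]}) H : skew_zero_diag B ->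
  \sum_j x j * \sum_i B j i *: (x i ^+ q - H * x i)
  = \sum_i \sum_j B^T i j *: (x i ^+ q * x j).
Proof.
move=> hB; under eq_bigr do rewrite mulr_sumr.
rewrite exchange_big.
transitivity (\sum_j \sum_i (B i j *: (x j ^+ q * x i) - H * (B i j *: (x i * x j)))).
  apply: eq_bigr => j _; apply: eq_bigr => i _.
  rewrite -scalerAr mulrBr scalerBr mulrC; congr (_ - _).
  by rewrite -scalerAr mulrCA.
under eq_bigr do rewrite sumrB; rewrite sumrB [X in _ - X](_ : _ = 0) ?subr0.
  by apply: eq_bigr => j _; apply: eq_bigr => i _; rewrite mxE.
transitivity (H * \sum_i \sum_j B i j *: (x i * x j)); last by rewrite sum_skew ?mulr0.
rewrite exchange_big mulr_sumr; apply: eq_bigr => i _; by rewrite mulr_sumr.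
Qed.

Lemma frob10_homog d F : (0 < d)%N -> F \is d.-homog -> frob10 q F \is (q.-1 + d)%N.-homog.
Proof.
move=> d0 hF; apply: rpred_sum => i _.
have -> : (q.-1 + d = q + d.-1)%N by have := card_gt1; lia.
by apply: dhomogM (mderiv_homog i hF); rewrite mpolyXn dhomogX /= mdegMn mdeg1 mul1n.
Qed.

Lemma frob10_quotient_homog d F : (0 < d)%N -> F \is d.-homog ->
  frobenius_nonclassical q F ->
  exists2 H, H \is q.-1.-homog & frob10 q F = H * F.
Proof.
move=> d0 hF [H e]; exists (pihomog mdeg q.-1 H); first exact: pihomogP.
rewrite -(pihomog_dE (frob10_homog d0 hF)) e (pihomogM_dhomog _ _ hF).
by rewrite ltnNge leq_addl addnK.
Qed.

End FrobeniusForms.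

Section FrobeniusLinear.

Variables (K : finFieldType) (p : nat).
Hypothesis hchar : p \in [pchar K].
Local Notation q := #|K|.

Lemma pnat_card : p.-nat q.
Proof.
have /abelem_pgroup := fin_ring_pchar_abelem hchar.
by rewrite /pgroup cardsT.
Qed.

Lemma dvdp_card : (p %| q)%N.
Proof.
have pr := pcharf_prime hchar; have [k e] := p_natP pnat_card.
by rewrite e; case: k e => [e|k _]; [move: (@card_gt1 K); rewrite e|rewrite dvdn_exp].
Qed.

Lemma natq0 : q%:R = 0 :> K.
Proof. by apply/eqP; rewrite -(dvdn_pcharf hchar) dvdp_card. Qed.

Variable n : nat.
Implicit Types (F G : {mpoly K[n]}) (i j : 'I_n).

Lemma frobD F G : (F + G) ^+ q = F ^+ q + G ^+ q.
Proof.
apply: exprDn_pchar; apply: sub_in_pnat pnat_card => r _ /eqP -> /=.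
by rewrite pchar_lalg.
Qed.

Lemma frob_lin (I : finType) (v : I -> K) (x : I -> {mpoly K[n]}) :
  (\sum_i v i *: x i) ^+ q = \sum_i v i *: x i ^+ q.
Proof.
elim/big_rec2: _ => [|i F G _ <-]; first by rewrite expr0n (gtn_eqF (ltnW (@card_gt1 K))).
by rewrite frobD exprZn expf_card.
Qed.

Lemma mderivXq i j : ('X_i ^+ q : {mpoly K[n]})^`M(j) = 0.
Proof.
rewrite mpolyXn mderivX mulmnE mnm1E; case: eqP => _; last by rewrite mul0n scale0r.
by rewrite mul1n natq0 scale0r.
Qed.

Lemma mderiv_frob_form (A : 'M[K]_n) j :
  (frob_form q A)^`M(j) = \sum_i A i j *: 'X_i ^+ q.
Proof.
rewrite frob_formE raddf_sum; apply: eq_bigr => i _ /=.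
rewrite raddf_sum (bigD1 j) //= big1 ?addr0 => [|k ne].
  by rewrite mderivZ mderivM mderivXq mul0r add0r mderivXU eqxx mulr1.
by rewrite mderivZ mderivM mderivXq mul0r add0r mderivXU (negPf ne) mulr0 scaler0.
Qed.

Lemma frob10_frob_form (A : 'M[K]_n) : skew_zero_diag A -> frob10 q (frob_form q A) = 0.
Proof.
move=> /skew_tr hA; rewrite /frob10 -[RHS](sum_skew (fun i => 'X_i ^+ q) hA).
apply: eq_bigr => j _; rewrite mderiv_frob_form mulr_sumr.
by apply: eq_bigr => i _; rewrite mxE scalerAr.
Qed.

Lemma frob10_lin_subst M F : frob10 q (lin_subst M F) = lin_subst M (frob10 q F).
Proof.
rewrite /frob10 rmorph_sum /=.
under eq_bigr do rewrite mderiv_lin_subst mulr_sumr.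
rewrite exchange_big; apply: eq_bigr => i _.
rewrite rmorphM rmorphXn /= lin_substX frob_lin mulr_suml; apply: eq_bigr => j _.
by rewrite -scalerAr scalerAl.
Qed.

End FrobeniusLinear.

Lemma sum_option (V : nmodType) (I : finType) (g : option I -> V) :
  \sum_l g l = g None + \sum_i g (Some i).
Proof.
rewrite (bigD1 None) //= (reindex_omap Some id) => [|[]//]; congr (_ + _).
by apply: eq_bigl => i; rewrite /= eqxx.
Qed.

Section SmoothSyzygies.

Variables (K : finFieldType) (n : nat).
Implicit Types F : {mpoly K[n]}.

Definition jac F (l : option 'I_n) : {mpoly K[n]} := if l is Some i then F^`M(i) else F.

Lemma jac_homog d F l : F \is d.-homog -> jac F l \is (if l then d.-1 else d).-homog.
Proof. by move=> hF; case: l => [i|//]; apply: mderiv_homog. Qed.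

Lemma smooth_jac d F : F \is d.-homog -> smooth_hypersurface F ->
  exists M, forall i, exists a : option 'I_n -> {mpoly K[n]}, 'X_i ^+ M = \sum_l a l * jac F l.
Proof.
move=> hF smF; apply: (@homogeneous_nullstellensatz K n _ (jac F)
  (fun l : option 'I_n => if l then d.-1 else d)).
  by move=> l; apply: jac_homog.
move=> L iota x x0 zero_x; apply: (smF L iota x x0); split; first exact: (zero_x None).
by move=> i; apply: (zero_x (Some i)).
Qed.

Lemma smooth_partials d F : F \is d.-homog -> smooth_hypersurface F -> d%:R != 0 :> K ->
  exists M, forall i, exists a : 'I_n -> {mpoly K[n]}, 'X_i ^+ M = \sum_l a l * F^`M(l).
Proof.
move=> hF smF d0; have [M f_in] := smooth_jac hF smF; exists M => i.
have [a ->] := f_in i; exists (fun l => a (Some l) + (d%:R^-1 *: a None) * 'X_l).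
rewrite sum_option /=; under [RHS]eq_bigr do rewrite mulrDl -mulrA.
rewrite big_split -mulr_sumr /= (euler_homog hF) addrC; congr (_ + _).
by rewrite -scalerAl -scalerAr scalerA mulVf // scale1r.
Qed.

Lemma partial_syzygy d r F (c : 'I_n -> {mpoly K[n]}) :
  F \is d.-homog -> smooth_hypersurface F -> d%:R != 0 :> K ->
  (forall i, c i \is r.-homog) -> (r <= d.-1)%N -> \sum_i c i * F^`M(i) = 0 ->
  exists2 A : 'M[K]_n, skew_zero_diag A &
    forall i, c i = if d.-1 == r then \sum_l A i l *: F^`M(l) else 0.
Proof.
move=> hF smF d0 hc le_r c0; have [M f_in] := smooth_partials hF smF d0.
have [|A [A0 AN cA]] := syzygy1 f_in _ c0; first by rewrite card_ord.
exists (\matrix_(i, l) (A i l)@_0).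
  split; last by move=> i; rewrite mxE A0 mcoeff0.
  by apply/matrixP => i j; rewrite !mxE AN mcoeffN.
move=> i; rewrite [LHS](homog_comb (hc i) (fun l => mderiv_homog l hF) _ (cA i)) //.
case: ifP => _; last by rewrite big_pred0.
by apply: eq_bigr => l _; rewrite mxE.
Qed.

Lemma partials_free d F (v : 'rV[K]_n) : F \is d.-homog -> smooth_hypersurface F ->
  d%:R != 0 :> K -> (1 < d)%N -> \sum_l v 0 l *: F^`M(l) = 0 -> v = 0.
Proof.
move=> hF smF d0 d1 v0.
have [|||A _ cA] := partial_syzygy (r := 0) (c := fun i => (v 0 i)%:MP) hF smF d0.
- by move=> i; rewrite -[_%:MP]mulr1 mul_mpolyC; apply: rpredZ; exact: dhomog1.
- by [].
- by rewrite -[RHS]v0; apply: eq_bigr => l _; rewrite mul_mpolyC.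
apply/rowP => i; rewrite mxE; have := cA i.
rewrite (_ : (_ == _) = false); last by lia.
by move/eqP; rewrite mpolyC_eq0 => /eqP.
Qed.

End SmoothSyzygies.

Section Nonclassical.

Variable K : finFieldType.
Local Notation q := #|K|.

Lemma nonclassical_syzygy n d (F H : {mpoly K[n]}) :
  F \is d.-homog -> smooth_hypersurface F -> d%:R != 0 :> K -> (q <= d.-1)%N ->
  H \is q.-1.-homog -> frob10 q F = H * F ->
  exists2 A : 'M[K]_n, skew_zero_diag A &
    forall i, 'X_i ^+ q - (d%:R^-1 *: H) * 'X_i
              = if d.-1 == q then \sum_l A i l *: F^`M(l) else 0.
Proof.
move=> hF smF d0 le_q hH e; apply: partial_syzygy => // [i|].
  apply: rpredB; first by rewrite mpolyXn dhomogX /= mdegMn mdeg1 mul1n.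
  have -> : q = (q.-1 + 1)%N by have := @card_gt1 K; lia.
  by apply: dhomogM; [apply: rpredZ|exact: dhomogXU].
under eq_bigr do rewrite mulrBl -mulrA.
rewrite sumrB -mulr_sumr (euler_homog hF) -/(frob10 q F) e.
by rewrite -scalerAl -scalerAr scalerA mulVf // scale1r subrr.
Qed.

Lemma frob_mon_neq n (i j : 'I_n) : i != j ->
  'X_i ^+ q * 'X_j != 'X_j ^+ q * 'X_i :> {mpoly K[n]}.
Proof.
move=> /negPf ne; apply/eqP => /(congr1 (mcoeff (U_(i) *+ q + U_(j))%MM)).
by rewrite !(mcoeff_frob_mon) !eqxx eq_sym ne => /eqP; rewrite oner_eq0.
Qed.

Lemma nonclassical_bound n d (F H : {mpoly K[n.+2]}) :
  F \is d.-homog -> smooth_hypersurface F -> d%:R != 0 :> K ->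
  H \is q.-1.-homog -> frob10 q F = H * F -> (d <= q.+1)%N.
Proof.
move=> hF smF d0 hH e; case: leqP => // lt_q.
have [|A _ cA] := nonclassical_syzygy hF smF d0 _ hH e; first by lia.
have c0 i : 'X_i ^+ q = (d%:R^-1 *: H) * 'X_i.
  apply/eqP; rewrite -subr_eq0 cA (_ : (d.-1 == q) = false) //; lia.
have := @frob_mon_neq n.+2 0 1 isT.
by rewrite !c0 mulrAC eqxx.
Qed.

Lemma invmx_comb (V : lmodType K) n (A : 'M[K]_n) (x y : 'I_n -> V) : A \in unitmx ->
  (forall i, x i = \sum_l A i l *: y l) -> forall j, y j = \sum_i invmx A j i *: x i.
Proof.
move=> uA xA j; under eq_bigr do rewrite xA scaler_sumr.
have BA l : \sum_i invmx A j i * A i l = (j == l)%:R.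
  by have /matrixP/(_ j l) := mulVmx uA; rewrite !mxE.
rewrite exchange_big; under eq_bigr => l _.
  by under eq_bigr do rewrite scalerA; rewrite -scaler_suml BA; over.
rewrite (bigD1 j) //= eqxx scale1r big1 ?addr0 // => l ne.
by rewrite eq_sym (negPf ne) scale0r.
Qed.

Variable p : nat.
Hypothesis hchar : p \in [pchar K].

Lemma succ_card_natr : q.+1%:R = 1 :> K.
Proof. by rewrite -addn1 natrD (natq0 hchar) add0r. Qed.

Lemma skew_form_of_unit n (F H : {mpoly K[n]}) (A : 'M[K]_n) :
  F \is q.+1.-homog -> skew_zero_diag A -> A \in unitmx ->
  (forall i, 'X_i ^+ q - H * 'X_i = \sum_l A i l *: F^`M(l)) ->
  F = frob_form q (invmx A)^T.
Proof.
move=> hF hA uA cA; have hB := skew_inv uA hA; set B := invmx A in hB *.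
have FB j : F^`M(j) = \sum_i B j i *: ('X_i ^+ q - H * 'X_i).
  exact: (invmx_comb uA cA).
have /esym := euler_homog hF; rewrite succ_card_natr scale1r => ->.
under eq_bigr do rewrite FB.
by rewrite skew_contract // frob_formE.
Qed.

End Nonclassical.

(** * Degree q + 1 *)

Section Singular.

Variable K : finFieldType.
Local Notation q := #|K|.

Variable n : nat.
Local Notation X0 := ('X_ord0 : {mpoly K[n.+1]}).
Local Notation y i := ('X_(lift ord0 i) : {mpoly K[n.+1]}).

Lemma frob_form_tailE (B : 'M[K]_n) :
  frob_form_tail q B = \sum_i \sum_j B i j *: (y i ^+ q * y j).
Proof.
apply: eq_bigr => i _; apply: eq_bigr => j _.
by rewrite mulrAC mulrC mul_mpolyC.
Qed.

Lemma mulX_mderivXn (m : nat) : X0 * (X0 ^+ m)^`M(ord0) = m%:R *: X0 ^+ m.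
Proof.
elim: m => [|m IH]; first by rewrite expr0 -mpolyC1 mderivC mulr0 scale0r.
rewrite exprS mderivM mderivXU eqxx mul1r mulrDr mulrCA IH -scalerAr -exprS.
by rewrite -natr1 scalerDl scale1r addrC.
Qed.

Lemma mcoeff_pure_y (i k : 'I_n) : (y i ^+ q - X0 ^+ q.-1 * y i)@_(U_(lift ord0 k) *+ q)
  = (i == k)%:R.
Proof.
have q1 := @card_gt1 K.
rewrite mcoeffB !mpolyXn -mpolyXD !mcoeffX.
have -> : ((U_(lift ord0 i) *+ q == U_(lift ord0 k) *+ q) = (i == k))%MM.
  apply/eqP/eqP => [/mnmP/(_ (lift ord0 k))|-> //].
  rewrite !mulmnE !mnm1E eqxx (inj_eq lift_inj).
  by case: eqP => // _; rewrite mul0n mul1n; lia.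
rewrite (_ : (U_(ord0) *+ q.-1 + U_(lift ord0 i) == U_(lift ord0 k) *+ q)%MM = false) ?subr0 //.
apply/eqP => /mnmP/(_ ord0); rewrite mnmDE !mulmnE !mnm1E eqxx ![lift _ _ == _]eq_sym.
by rewrite !(negPf (neq_lift _ _)) mul1n; lia.
Qed.

Lemma mcoeff_mixed_y (i k : 'I_n) :
  (X0 ^+ q.-1 * y i)@_(U_(ord0) *+ q.-1 + U_(lift ord0 k)) = (i == k)%:R.
Proof.
rewrite mpolyXn -mpolyXD mcoeffX; congr (_%:R); congr nat_of_bool.
apply/eqP/eqP => [/mnmP/(_ (lift ord0 k))|-> //].
by rewrite !mnmDE !mnm1E eqxx (inj_eq lift_inj) => /addnI; case: eqP.
Qed.

Variable p : nat.
Hypothesis hchar : p \in [pchar K].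

Lemma pchar2 : 2%:R = 0 :> K -> p = 2.
Proof.
move=> /eqP; rewrite -(dvdn_pcharf hchar) => p2.
by apply/eqP; rewrite -dvdn_prime2 ?(pcharf_prime hchar).
Qed.

Lemma mderiv_tail0 (B : 'M[K]_n) : (frob_form_tail q B)^`M(ord0) = 0.
Proof.
rewrite frob_form_tailE raddf_sum big1 // => i _; rewrite raddf_sum big1 // => j _ /=.
by rewrite mderivZ mderivM (mderivXq hchar) mderivXU mul0r mulr0 addr0 scaler0.
Qed.

Lemma mderiv_tail (B : 'M[K]_n) k :
  (frob_form_tail q B)^`M(lift ord0 k) = \sum_i B i k *: y i ^+ q.
Proof.
rewrite frob_form_tailE raddf_sum; apply: eq_bigr => i _ /=.
rewrite raddf_sum (bigD1 k) //= big1 ?addr0 => [|j ne]; rewrite mderivZ mderivM.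
  by rewrite (mderivXq hchar) mderivXU eqxx mul0r mulr1 add0r.
by rewrite (mderivXq hchar) mderivXU (inj_eq lift_inj) (negPf ne) mul0r mulr0 addr0 scaler0.
Qed.

Lemma singular_normal_form (F : {mpoly K[n.+1]}) : (0 < n)%N ->
  F \is q.+1.-homog -> smooth_hypersurface F -> frob10 q F = X0 ^+ q.-1 * F ->
  [/\ ~~ odd n, p = 2 & exists (G : {mpoly K[n.+1]}) (B : 'M[K]_n),
      [/\ G^`M(ord0) = 0, skew_zero_diag B, \det B != 0 & F = X0 * G + frob_form_tail q B]].
Proof.
move=> n0 hF smF e; have q1 := @card_gt1 K.
have d1 := succ_card_natr hchar.
have d0 : q.+1%:R != 0 :> K by rewrite d1 oner_eq0.
have hX : X0 ^+ q.-1 \is q.-1.-homog by rewrite mpolyXn dhomogX /= mdegMn mdeg1 mul1n.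
have [//|A hA] := nonclassical_syzygy hF smF d0 _ hX e.
rewrite d1 invr1 scale1r eqxx => cA; have [_ A0] := hA.
have A_row0 l : A ord0 l = 0.
  have /rowP/(_ l) : row ord0 A = 0.
    apply: (partials_free hF smF d0) => //; first by lia.
    under eq_bigr do rewrite mxE.
    by rewrite -cA -exprSr prednK ?subrr //; lia.
  by rewrite !mxE.
pose B0 : 'M[K]_n := \matrix_(i, j) A (lift ord0 i) (lift ord0 j).
have hB0 : skew_zero_diag B0.
  split=> [|i]; last by rewrite mxE A0.
  by apply/matrixP => i j; rewrite !mxE; exact: skew_zero_diagN.
have cB i : y i ^+ q - X0 ^+ q.-1 * y i = \sum_j B0 i j *: F^`M(lift ord0 j).
  rewrite cA big_ord_recl (skew_zero_diagN _ _ hA) A_row0 oppr0 scale0r add0r.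
  by apply: eq_bigr => j _; rewrite mxE.
have uB0 : B0 \in unitmx.
  apply/negPn/negP => /singular_row [u u0 uB]; case/eqP: u0.
  have : \sum_i u 0 i *: (y i ^+ q - X0 ^+ q.-1 * y i) = 0.
    under eq_bigr do rewrite cB scaler_sumr; rewrite exchange_big big1 // => j _.
    under eq_bigr do rewrite scalerA; rewrite -scaler_suml.
    by have /rowP/(_ j) := uB; rewrite !mxE => ->; rewrite scale0r.
  move=> s0; apply/rowP => k; rewrite mxE -(mcoeff0 _ (U_(lift ord0 k) *+ q)%MM) -s0.
  rewrite raddf_sum (bigD1 k) //= mcoeffZ mcoeff_pure_y eqxx mulr1 big1 ?addr0 // => i ne.
  by rewrite mcoeffZ mcoeff_pure_y (negPf ne) mulr0.
have n_even : ~~ odd n.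
  by apply/negP => /(det_skew_odd hB0) det0; move: uB0; rewrite unitmxE det0 unitr0.
have hB := skew_inv uB0 hB0; have DB := invmx_comb uB0 cB.
set B := invmx B0 in hB DB *.
have detB : \det B != 0 by rewrite -unitfE -unitmxE unitmx_inv.
have FE : F = X0 * F^`M(ord0) + frob_form_tail q B^T.
  have := euler_homog hF; rewrite d1 scale1r => {1}<-.
  rewrite big_ord_recl; congr (_ + _); under eq_bigr do rewrite DB.
  by rewrite skew_contract // frob_form_tailE.
have D00 : F^`M(ord0)^`M(ord0) = 0.
  have := congr1 (mderiv ord0) FE; rewrite mderivD mderivM mderivXU eqxx mul1r.
  rewrite mderiv_tail0 addr0 => /esym/eqP; rewrite -subr_eq0 addrAC subrr add0r.
  by rewrite mulf_eq0 mpolyX_eq0 => /eqP.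
have q1N : q.-1%:R = -1 :> K.
  by apply/eqP; rewrite -subr_eq0 opprK -mulrSr prednK ?(natq0 hchar) //; lia.
have X0D k : X0 * F^`M(lift ord0 k)^`M(ord0) = \sum_i B k i *: (X0 ^+ q.-1 * y i).
  rewrite DB raddf_sum mulr_sumr; apply: eq_bigr => i _ /=.
  rewrite mderivZ -scalerAr mderivB (mderivXq hchar) mderivM mderivXU mulr0 addr0 sub0r.
  by rewrite mulrN mulrA mulX_mderivXn q1N scaleN1r mulNr opprK.
have Dk k : 2%:R *: (\sum_i B k i *: (X0 ^+ q.-1 * y i)) = 0.
  have E1 : F^`M(lift ord0 k)
      = \sum_i B k i *: (X0 ^+ q.-1 * y i) + \sum_i B k i *: y i ^+ q.
    rewrite {1}FE mderivD mderivM mderivXU /= mul0r add0r mderiv_tail mderiv_comm X0D.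
    by congr (_ + _); apply: eq_bigr => i _; rewrite mxE.
  have E2 : F^`M(lift ord0 k)
      = \sum_i B k i *: y i ^+ q - \sum_i B k i *: (X0 ^+ q.-1 * y i).
    by rewrite DB -sumrB; apply: eq_bigr => i _; rewrite scalerBr.
  move: E1; rewrite E2 [RHS]addrC => /addrI/eqP; rewrite eq_sym -subr_eq0 opprK.
  by rewrite scaler_nat mulr2n => /eqP.
split=> //; last first.
  by exists F^`M(ord0), B^T; split=> //; [exact: skew_tr|rewrite det_tr].
apply: pchar2; apply/eqP; apply: contraNT detB => two0.
suff -> : B = 0 by case: (n) n0 => // n' _; rewrite det0.
apply/matrixP => k l; rewrite mxE.
have /eqP := Dk k; rewrite mscalerI (negPf two0) => /eqP.
move/(congr1 (mcoeff (U_(ord0) *+ q.-1 + U_(lift ord0 l))%MM)).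
rewrite mcoeff0 raddf_sum (bigD1 l) //= mcoeffZ mcoeff_mixed_y eqxx mulr1 big1 ?addr0 // => i ne.
by rewrite mcoeffZ mcoeff_mixed_y (negPf ne) mulr0.
Qed.

End Singular.

Section VanishingFrob10.

Variable K : finFieldType.
Local Notation q := #|K|.

Lemma frob10_eq0_partials n d (F : {mpoly K[n]}) : (d <= q)%N -> F \is d.-homog ->
  frob10 q F = 0 -> forall i, F^`M(i) = 0.
Proof.
move=> le_d hF e i; apply/mpolyP => m; rewrite mcoeff0; apply/eqP; apply: contraT => Fm.
have q1 := @card_gt1 K.
have m_lt : (mdeg m < q)%N.
  have := dhomog_mf (mderiv_homog i hF); move/(_ m); rewrite mcoeff_msupp Fm => /(_ isT) /=.
  by move=> ->; move: le_d q1 => /=; lia.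
suff E : (frob10 q F)@_(U_(i) *+ q + m) = (F^`M(i))@_m.
  by move: Fm; rewrite -E e mcoeff0 eqxx.
rewrite /frob10 (bigD1 i) //= mcoeffD mpolyXn (mulrC 'X_[_]) mcoeffMX.
rewrite [X in _ + X](_ : _ = 0) ?addr0 // raddf_sum big1 // => j ne /=.
rewrite mpolyXn mulrC memN_msupp_eq0 // (perm_mem (msuppMX _ _)).
have mj : (m j < q)%N.
  by apply: leq_ltn_trans m_lt; rewrite mdegE (bigD1 j) //= leq_addr.
apply/mapP => -[m' _ /mnmP/(_ j)]; rewrite !mnmDE !mulmnE !mnm1E eqxx eq_sym (negPf ne).
by rewrite mul0n mul1n add0n => mE; rewrite mE ltnNge leq_addr in mj.
Qed.

Lemma frob10_eq0_degree n d (F : {mpoly K[n.+2]}) : (0 < d)%N -> F != 0 -> F \is d.-homog ->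
  smooth_hypersurface F -> frob10 q F = 0 -> (q < d)%N.
Proof.
move=> d0 F0 hF smF e; case: ltnP => // le_d.
have dF0 := frob10_eq0_partials le_d hF e.
have [M f_in] := smooth_jac hF smF.
have lead i : exists m, (U_(i) *+ M = m + mlead F)%MM.
  have [a] := f_in i; rewrite sum_option big1 ?addr0 => [|j _]; last by rewrite /= dF0 mulr0.
  move=> aF; have a0 : a None != 0.
    by apply/eqP => a0; have := mpolyX_eq0 K (U_(i) *+ M); rewrite -mpolyXn aF a0 mul0r eqxx.
  exists (mlead (a None)); rewrite -mleadM // -aF mpolyXn.
  by rewrite mleadXm.
have [m0 e0] := lead 0; have [m1 e1] := lead 1.
have : mdeg (mlead F) = d by apply: (dhomog_mf hF); apply: mlead_supp.
suff -> : mlead F = 0%MM by rewrite mdeg0 => H; rewrite -H in d0.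
apply/mnmP => j; rewrite mnm0E.
have := congr1 (fun m : 'X_{1..n.+2} => m j) e0; have := congr1 (fun m : 'X_{1..n.+2} => m j) e1.
rewrite !mnmDE !mulmnE !mnm1E; case: (eqVneq 0 j) => [<-|_] /=; lia.
Qed.

End VanishingFrob10.

Section DegreeSucc.

Variables (K : finFieldType) (p : nat).
Hypothesis hchar : p \in [pchar K].
Local Notation q := #|K|.

Lemma degree_succ_dichotomy n (F H : {mpoly K[n.+1]}) : (0 < n)%N ->
  F \is q.+1.-homog -> smooth_hypersurface F ->
  H \is q.-1.-homog -> frob10 q F = H * F ->
  (odd n /\ exists A : 'M[K]_n.+1, [/\ skew_zero_diag A, \det A != 0 & F = frob_form q A])
  \/
  [/\ ~~ odd n, p = 2 & exists2 M : 'M[K]_n.+1, M \in unitmx &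
     frob10 q (lin_subst M F) = 'X_ord0 ^+ q.-1 * lin_subst M F /\
     exists (G : {mpoly K[n.+1]}) (B : 'M[K]_n),
      [/\ G^`M(ord0) = 0, skew_zero_diag B, \det B != 0
        & lin_subst M F = 'X_ord0 * G + frob_form_tail q B]].
Proof.
move=> n0 hF smF hH e; have d1 := succ_card_natr hchar.
have d0 : q.+1%:R != 0 :> K by rewrite d1 oner_eq0.
have [//|A hA] := nonclassical_syzygy hF smF d0 _ hH e.
rewrite d1 invr1 scale1r eqxx => cA.
have [uA|/singular_row [v v0 vA]] := boolP (A \in unitmx).
  left; split.
    apply: contraLR uA => /= n_even; rewrite unitmxE det_skew_odd ?unitr0 //.
  exists (invmx A)^T; split; [exact/skew_tr/skew_inv| |exact: (skew_form_of_unit hchar hF hA uA cA)].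
  by rewrite det_tr -unitfE -unitmxE unitmx_inv.
right; pose ell : {mpoly K[n.+1]} := \sum_i v 0 i *: 'X_i.
have ell0 : ell != 0.
  apply: contra_neq v0 => ell0; apply/rowP => k; rewrite mxE.
  rewrite -(mcoeff0 _ U_(k)%MM) -ell0 raddf_sum (bigD1 k) //= mcoeffZ mcoeffXU eqxx mulr1.
  by rewrite big1 ?addr0 // => i ne; rewrite mcoeffZ mcoeffXU (negPf ne) mulr0.
have ellq : ell ^+ q = H * ell.
  apply/eqP; rewrite -subr_eq0 (frob_lin hchar) mulr_sumr -sumrB; apply/eqP.
  under eq_bigr do rewrite -scalerAr -scalerBr cA scaler_sumr.
  rewrite exchange_big big1 // => l _; under eq_bigr do rewrite scalerA.
  rewrite -scaler_suml; have /rowP/(_ l) := vA; rewrite !mxE => ->.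
  by rewrite scale0r.
have HE : H = ell ^+ q.-1.
  apply: (mulIf ell0); rewrite -ellq -exprSr prednK //.
  exact: ltnW (card_gt1 K).
have [M uM vM] := row_to_first v0.
have ellM : lin_subst M ell = 'X_ord0.
  rewrite rmorph_sum /=; under eq_bigr do rewrite lin_substZ lin_substX scaler_sumr.
  rewrite exchange_big /=.
  transitivity (\sum_j (v *m M) 0 j *: 'X_j : {mpoly K[n.+1]}).
    apply: eq_bigr => j _; rewrite mxE scaler_suml.
    by apply: eq_bigr => i _; rewrite scalerA.
  rewrite vM (bigD1 ord0) //= mxE !eqxx scale1r big1 ?addr0 // => j ne.
  by rewrite mxE (negPf ne) scale0r.
have eM : frob10 q (lin_subst M F) = 'X_ord0 ^+ q.-1 * lin_subst M F.
  by rewrite (frob10_lin_subst hchar) e HE rmorphM rmorphXn /= ellM.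
have [] := singular_normal_form hchar n0 (lin_subst_homog M hF) (smooth_lin_subst uM smF) eM.
by move=> n_even p2 GB; split=> //; exists M.
Qed.

End DegreeSucc.

(** * Degree q + 2 *)

Section DegreeDivisible.

Variable K : finFieldType.
Local Notation q := #|K|.

Definition frob_minor n (i j : 'I_n) : {mpoly K[n]} :=
  'X_j ^+ q * 'X_i - 'X_i ^+ q * 'X_j.

Lemma frob_minor_homog n (i j : 'I_n) : frob_minor i j \is q.+1.-homog.
Proof.
by apply: rpredB; rewrite mpolyXn -mpolyXD dhomogX /= mdegD mdegMn !mdeg1 mul1n addn1.
Qed.

Lemma mcoeff_frob_minor n (i j k l : 'I_n) : (i < j)%N -> (k < l)%N ->
  (frob_minor i j)@_(U_(l) *+ q + U_(k)) = ((i == k) && (j == l))%:R.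
Proof.
move=> ij kl; rewrite mcoeffB !mcoeff_frob_mon andbC.
case: (i =P l) => [il|_]; last by rewrite subr0.
case: (j =P k) => [jk|_]; last by rewrite subr0.
by move: ij kl; rewrite il jk; lia.
Qed.

Lemma divisible_minors n d (F H : {mpoly K[n.+2]}) :
  F \is d.-homog -> smooth_hypersurface F -> d%:R = 0 :> K -> (q.+2 <= d)%N ->
  frob10 q F = H * F ->
  d = q.+2 /\ exists T : 'I_n.+2 -> 'I_n.+2 -> 'I_n.+2 -> K,
    [/\ forall l i, T l i i = 0, forall l i j, T l i j = - T l j i,
        forall l i j, T l i j = - T i l j, forall i j, T i i j = 0
      & forall i j, frob_minor i j = \sum_l T l i j *: F^`M(l)].
Proof.
move=> hF smF d0 le_d e; have [M f_in] := smooth_jac hF smF.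
have eul := euler_homog hF; rewrite d0 scale0r in eul.
pose W (u v : option 'I_n.+2) : {mpoly K[n.+2]} :=
  match u, v with
  | Some i, Some j => frob_minor i j
  | None, Some j => H * 'X_j
  | Some i, None => - (H * 'X_i)
  | None, None => 0
  end.
have [||||T [T0 TN T12 T10 WT]] := syzygy2 f_in (W := W).
- by rewrite card_option card_ord.
- by case=> [i|//]; rewrite /= /frob_minor subrr.
- by case=> [i|] [j|] //=; rewrite ?opprB ?opprK ?oppr0.
- case=> [j|]; rewrite sum_option /=; last first.
    rewrite mul0r add0r; under eq_bigr do rewrite mulNr -mulrA.
    by rewrite sumrN -mulr_sumr eul mulr0 oppr0.
  under eq_bigr do rewrite /frob_minor mulrBl.
  rewrite sumrB; under eq_bigr do rewrite -mulrA.
  rewrite -mulr_sumr eul mulr0 sub0r; under eq_bigr do rewrite mulrAC.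
  by rewrite -mulr_suml -/(frob10 q F) e mulrAC subrr.
have minorT i j : frob_minor i j
    = \sum_(l : option 'I_n.+2 | (if l then d.-1 else d) == q.+1) (T l (Some i) (Some j))@_0 *: jac F l.
  apply: (homog_comb (frob_minor_homog i j) (fun l => jac_homog l hF) _ (WT (Some i) (Some j))).
  by case=> [l|]; move: le_d => /=; lia.
have dE : d = q.+2.
  apply/eqP; rewrite eqn_leq le_d andbT leqNgt; apply/negP => lt_d.
  have := frob_mon_neq K (n := n.+2) (i := 1) (j := 0) isT.
  rewrite -subr_eq0 -/(frob_minor _ _) minorT big_pred0 ?eqxx //.
  by case=> [l|]; move: lt_d => /=; lia.
split=> //; exists (fun l i j => (T (Some l) (Some i) (Some j))@_0); split.
- by move=> l i; rewrite T0 mcoeff0.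
- by move=> l i j; rewrite TN mcoeffN.
- by move=> l i j; rewrite T12 mcoeffN.
- by move=> i j; rewrite T10 mcoeff0.
move=> i j; rewrite minorT big_mkcond sum_option /= ifF; last by move: dE => /=; lia.
by rewrite add0r; apply: eq_bigr => l _; rewrite ifT //; move: dE => /=; lia.
Qed.

(* In N >= 4 variables the N (N - 1) / 2 minors are linearly independent, too
   many for the span of N polynomials; N + 1 of them are enough. *)
Lemma minors_dim n (D : 'I_n.+4 -> {mpoly K[n.+4]}) (T : 'I_n.+4 -> 'I_n.+4 -> 'I_n.+4 -> K) :
  ~ forall i j, frob_minor i j = \sum_l T l i j *: D l.
Proof.
move=> minorT.
pose pr (k : 'I_n.+4.+1) : 'I_n.+4 * 'I_n.+4 :=
  if (k < n.+3)%N then (inord 0, inord k.+1)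
  else if (k == n.+3 :> nat) then (inord 1, inord 2) else (inord 1, inord 3).
have prE k : ((pr k).1 = (if (k < n.+3)%N then 0 else 1) :> nat)%N /\
    ((pr k).2 = (if (k < n.+3)%N then k.+1 else if k == n.+3 :> nat then 2 else 3) :> nat)%N.
  rewrite /pr; case: ifP => [lt|_]; first by rewrite /= !inordK.
  by case: ifP => _; rewrite /= !inordK.
have pr_lt k : ((pr k).1 < (pr k).2)%N.
  by have [-> ->] := prE k; case: ifP => // _; case: ifP.
have pr_inj k k' : ((pr k').1 == (pr k).1) && ((pr k').2 == (pr k).2) = (k' == k).
  apply/andP/eqP => [[/eqP e1 /eqP e2]|->]; last by rewrite !eqxx.
  have [a1 a2] := prE k; have [b1 b2] := prE k'.
  move: (congr1 val e1) (congr1 val e2); rewrite /= a1 a2 b1 b2 => {a1 a2 b1 b2} c1 c2.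
  apply: val_inj => /=; have := ltn_ord k; have := ltn_ord k'; move: c1 c2.
  by do !case: ifP; lia.
pose A : 'M[K]_(n.+4.+1, n.+4) := \matrix_(k, l) T l (pr k).1 (pr k).2.
have : kermx A != 0.
  by rewrite kermx_eq0 /row_free neq_ltn (leq_ltn_trans (rank_leq_col A)).
case/rowV0Pn => u /sub_kermxP uA /eqP; apply.
have s0 : \sum_k u 0 k *: frob_minor (pr k).1 (pr k).2 = 0.
  under eq_bigr do rewrite minorT scaler_sumr.
  rewrite exchange_big big1 // => l _; under eq_bigr do rewrite scalerA.
  rewrite -scaler_suml; have /rowP/(_ l) := uA; rewrite !mxE.
  by under eq_bigr do rewrite mxE; move=> ->; rewrite scale0r.
apply/rowP => k; rewrite mxE -(mcoeff0 K (U_((pr k).2) *+ q + U_((pr k).1))%MM) -s0.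
rewrite raddf_sum (bigD1 k) //= mcoeffZ mcoeff_frob_minor // pr_inj eqxx mulr1.
by rewrite big1 ?addr0 // => k' ne; rewrite mcoeffZ mcoeff_frob_minor // pr_inj (negPf ne) mulr0.
Qed.

End DegreeDivisible.

Section Char2.

Variables (K : fieldType) (n : nat).
Hypothesis two0 : 2%:R = 0 :> K.
Implicit Types G Q : {mpoly K[n]}.

Lemma mpoly_addr2 Q : Q + Q = 0.
Proof. by rewrite -mulr2n -scaler_nat two0 scale0r. Qed.

HB.instance Definition _ :=
  GRing.RMorphism.copy (@sq_subst K n) (comp_mpoly [tuple 'X_i ^+ 2 | i < n]).

Lemma mderiv_sq_subst G i : (sq_subst G)^`M(i) = 0.
Proof.
elim/mpoly_ring_ind: G => [c|j|G Q IG IQ|G Q IG IQ].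
- by rewrite /sq_subst comp_mpolyC mderivC.
- by rewrite /sq_subst comp_mpolyXU -tnth_nth tnth_mktuple expr2 mderivM mulrC mpoly_addr2.
- by rewrite rmorphD /= mderivD IG IQ addr0.
- by rewrite rmorphM /= mderivM IG IQ mul0r mulr0 addr0.
Qed.

Lemma sq_substP Q : (forall i, Q^`M(i) = 0) -> exists G, Q = sq_subst G.
Proof.
move=> dQ.
have even_m m i : m \in msupp Q -> ~~ odd (m i).
  rewrite mcoeff_msupp; apply: contra => m_odd.
  have mi : (0 < m i)%N by case: (m i) m_odd.
  have := congr1 (mcoeff (m - U_(i))%MM) (dQ i); rewrite mcoeff0 mcoeff_deriv.
  have -> : (m - U_(i) + U_(i) = m)%MM.
    by apply/mnmP => j; rewrite mnmDE mnmBE mnm1E; case: eqP => [<-|_]; lia.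
  rewrite mnmBE mnm1E eqxx -subSn // subn1 /= -mulr_natr => /eqP; rewrite mulf_eq0.
  case/orP => // ; rewrite -[m i]odd_double_half m_odd natrD -muln2 natrM two0 mulr0 addr0.
  by rewrite oner_eq0.
exists (\sum_(m <- msupp Q) Q@_m *: 'X_[[multinom (m i)./2 | i < n]]).
rewrite [LHS]mpolyE rmorph_sum /= big_seq [RHS]big_seq; apply: eq_bigr => m m_in.
rewrite /sq_subst comp_mpolyZ comp_mpolyX; congr (_ *: _).
rewrite mpolyXE_id; apply: eq_bigr => i _; rewrite tnth_mktuple mnmE -exprM mul2n.
by rewrite even_halfK // even_m.
Qed.

End Char2.

Section Ternary.

Variables (K : finFieldType) (p : nat).
Hypothesis hchar : p \in [pchar K].
Local Notation q := #|K|.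

Definition tri_form n (a b c : 'I_n) : {mpoly K[n]} :=
  'X_a * 'X_b * 'X_c * ('X_a ^+ (q - 1) + 'X_b ^+ (q - 1) + 'X_c ^+ (q - 1)).

Lemma tri_formE n (a b c : 'I_n) :
  tri_form a b c = 'X_a ^+ q * ('X_b * 'X_c) + 'X_a * ('X_b ^+ q * 'X_c + 'X_b * 'X_c ^+ q).
Proof.
rewrite /tri_form; have q0 : (q = (q - 1).+1)%N by have := card_gt1 K; lia.
rewrite [in RHS]q0 !exprS; move: ('X_a ^+ _) ('X_b ^+ _) ('X_c ^+ _) => x y z.
by move: 'X_a 'X_b 'X_c => u v w; ring.
Qed.

Lemma tri_form_rot n (a b c : 'I_n) : tri_form b c a = tri_form a b c.
Proof.
rewrite /tri_form; move: ('X_a ^+ _) ('X_b ^+ _) ('X_c ^+ _) => x y z.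
by move: 'X_a 'X_b 'X_c => u v w; ring.
Qed.

Lemma mderiv_tri_form n (a b c : 'I_n) : b != a -> c != a ->
  (tri_form a b c)^`M(a) = 'X_b ^+ q * 'X_c + 'X_b * 'X_c ^+ q.
Proof.
move=> /negPf ba /negPf ca; rewrite tri_formE !(mderivD, mderivM) !(mderivXq hchar) !mderivXU.
by rewrite ba ca eqxx !(mul0r, mulr0, addr0, add0r, mul1r).
Qed.

Local Notation a := (inord 0 : 'I_3).
Local Notation b := (inord 1 : 'I_3).
Local Notation c := (inord 2 : 'I_3).

Lemma ord3_cases (P : 'I_3 -> Prop) : P a -> P b -> P c -> forall i, P i.
Proof.
move=> Pa Pb Pc i; rewrite -(inord_val i).
by case: i => [[|[|[|i]]]] //= _.
Qed.

Lemma sum_ord3 (V : nmodType) (g : 'I_3 -> V) : \sum_l g l = g a + g b + g c.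
Proof.
rewrite !big_ord_recl big_ord0 addr0 addrA.
by congr (g _ + g _ + g _); apply: val_inj; rewrite /= inordK.
Qed.

Lemma ternary_form (F : {mpoly K[3]}) (T : 'I_3 -> 'I_3 -> 'I_3 -> K) : 2%:R = 0 :> K ->
  (forall l i, T l i i = 0) -> (forall l i j, T l i j = - T l j i) ->
  (forall l i j, T l i j = - T i l j) -> (forall i j, T i i j = 0) ->
  (forall i j, frob_minor K i j = \sum_l T l i j *: F^`M(l)) ->
  frob10 q F = 0 /\
  exists (t : K) (G : {mpoly K[3]}), t != 0 /\ t *: F = tri_form a b c + sq_subst G.
Proof.
move=> two0 T0 TN T12 T10 minorT; pose t := T a b c.
have ab : b != a by rewrite -val_eqE /= !inordK.
have ac : c != a by rewrite -val_eqE /= !inordK.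
have bc : c != b by rewrite -val_eqE /= !inordK.
have Fa : t *: F^`M(a) = frob_minor K b c.
  by rewrite minorT sum_ord3 T10 (T12 c) T0 oppr0 !scale0r !addr0.
have Fb : t *: F^`M(b) = - frob_minor K a c.
  rewrite minorT sum_ord3 T10 (T12 c) T0 oppr0 !scale0r addr0 add0r.
  by rewrite (T12 b) scaleNr opprK.
have Fc : t *: F^`M(c) = frob_minor K a b.
  rewrite minorT sum_ord3 T10 (T12 b) T0 oppr0 !scale0r !add0r.
  by rewrite (T12 c) TN opprK.
have t0 : t != 0.
  apply/eqP => t0; have := frob_mon_neq K bc.
  by rewrite -subr_eq0 -/(frob_minor K b c) -Fa t0 scale0r eqxx.
split.
  apply/eqP; have /eqP : t *: frob10 q F = 0.
    rewrite /frob10 sum_ord3 !scalerDr !scalerAr Fa Fb Fc /frob_minor.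
    by ring.
  by rewrite mscalerI (negPf t0).
have [|G QG] := @sq_substP K 3 two0 (t *: F - tri_form a b c); last first.
  by exists t, G; split=> //; rewrite -QG addrC subrK.
have zero2 (x y z : {mpoly K[3]}) : x = y - (z + z) -> x = y.
  by rewrite mpoly_addr2 // subr0.
apply: ord3_cases; rewrite mderivB mderivZ.
- rewrite Fa mderiv_tri_form //; apply: (zero2 _ _ ('X_b ^+ q * 'X_c)).
  by rewrite /frob_minor; ring.
- rewrite Fb -tri_form_rot mderiv_tri_form // 1?eq_sym //.
  by apply: (zero2 _ _ ('X_c ^+ q * 'X_a)); rewrite /frob_minor; ring.
- rewrite Fc -tri_form_rot -tri_form_rot mderiv_tri_form // 1?eq_sym //.
  by apply: (zero2 _ _ ('X_a ^+ q * 'X_b)); rewrite /frob_minor; ring.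
Qed.

Lemma ternary_degree d (F G : {mpoly K[3]}) (t : K) : (0 < d)%N -> F \is d.-homog ->
  2%:R = 0 :> K -> t *: F = tri_form a b c + sq_subst G -> d = q.+2.
Proof.
move=> d0 hF two0 tF.
have ab : b != a by rewrite -val_eqE /= !inordK.
have ac : c != a by rewrite -val_eqE /= !inordK.
have bc : c != b by rewrite -val_eqE /= !inordK.
have := congr1 (mderiv a) tF.
rewrite mderivZ mderivD mderiv_sq_subst // addr0 mderiv_tri_form // => e.
have h1 : t *: F^`M(a) \is d.-1.-homog by apply/rpredZ/mderiv_homog.
have h2 : t *: F^`M(a) \is q.+1.-homog.
  by rewrite e; apply: rpredD; [|rewrite mulrC];
    rewrite mpolyXn -mpolyXD dhomogX /= mdegD mdegMn !mdeg1 mul1n addn1.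
have n0 : t *: F^`M(a) != 0.
  apply/eqP => z; have := congr1 (mcoeff (U_(b) *+ q + U_(c))%MM) e.
  rewrite z mcoeff0 mcoeffD [X in _ + X@__]mulrC !mcoeff_frob_mon !eqxx (negPf bc) addr0.
  by move/eqP; rewrite eq_sym oner_eq0.
by have := dhomog_uniq n0 h1 h2; lia.
Qed.

End Ternary.

Lemma tail_degree (K : finFieldType) n d (G : {mpoly K[n.+2]}) (B : 'M[K]_n.+1) :
  'X_ord0 * G + frob_form_tail #|K| B \is d.-homog -> \det B != 0 -> d = #|K|.+1.
Proof.
move=> hF; apply: contraNeq => ne; suff -> : B = 0 by rewrite det0.
apply/matrixP => k l; rewrite mxE.
set m := (U_(lift ord0 k) *+ #|K| + U_(lift ord0 l))%MM.
have /(dhomog_nemf_coeff hF) : mdeg m != d.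
  by rewrite mdegD mdegMn !mdeg1 mul1n addn1 eq_sym.
rewrite mcoeffD [X in X + _]memN_msupp_eq0 ?add0r.
  rewrite frob_form_tailE raddf_sum (bigD1 k) //= raddf_sum (bigD1 l) //=.
  rewrite mcoeffZ mcoeff_frob_mon !eqxx mulr1 !big1 ?addr0 //.
    move=> i /negPf ne'; rewrite raddf_sum big1 // => j _.
    by rewrite /= mcoeffZ mcoeff_frob_mon (inj_eq lift_inj) ne' mulr0.
  by move=> j /negPf ne'; rewrite mcoeffZ mcoeff_frob_mon !(inj_eq lift_inj) ne' andbF mulr0.
rewrite mulrC (perm_mem (msuppMX _ _)); apply/mapP => -[m' _ /mnmP/(_ ord0)].
by rewrite !mnmDE !mulmnE !mnm1E eqxx ![lift _ _ == _]eq_sym !(negPf (neq_lift _ _)).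
Qed.

Lemma degree_add2 (K : finFieldType) p m d (F H : {mpoly K[m.+3]}) :
  p \in [pchar K] -> F \is d.-homog -> smooth_hypersurface F ->
  frob10 #|K| F = H * F -> d%:R = 0 :> K -> (#|K|.+2 <= d)%N ->
  d = #|K|.+2 /\ p = 2 /\ m = 0%N /\ frob10 #|K| F = 0 /\
  exists (c : K) (G : {mpoly K[m.+3]}), c != 0 /\
    c *: F = tri_form K (inord 0) (inord 1) (inord 2) + sq_subst G.
Proof.
move=> hchar hF smF e d0 le_d.
have [dE [T [T0 TN T12 T10 minorT]]] := divisible_minors hF smF d0 le_d e.
have two0 : 2%:R = 0 :> K.
  by have := d0; rewrite dE -addn2 natrD (natq0 hchar) add0r.
split; first exact: dE.
split; first exact: (pchar2 hchar two0).
case: m F H hF smF e T T0 TN T12 T10 minorT => [|m] F H hF smF e T T0 TN T12 T10 minorT.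
  by split=> //; apply: (ternary_form hchar two0 T0 TN T12 T10 minorT).
by case: (minors_dim minorT).
Qed.

Theorem theorem1p6 (K : finFieldType) (p q n d : nat)
  (hp : prime p) (hchar : p \in [pchar K]) (hq : #|K| = q)
  (hn : (2 <= n)%N) (F : {mpoly K[n.+1]})
  (hF0 : F != 0) (hFd : F \is d.-homog) (hd : (2 <= d)%N)
  (hsmooth : smooth_hypersurface F) (hnc : frobenius_nonclassical q F) :
  (d <= q + 2)%N /\
  (* (1) *)
  ((d = q.+1 /\ odd n) <->
     exists A : 'M[K]_(n.+1),
       skew_zero_diag A /\ \det A != 0 /\ F = frob_form q A) /\
  (* (2) *)
  ((d = q.+1 /\ ~~ odd n) <->
     (p = 2%N /\
      exists M : 'M[K]_(n.+1), M \in unitmx /\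
        frob10 q (lin_subst M F) = 'X_ord0 ^+ (q - 1) * lin_subst M F /\
        exists (G : {mpoly K[n.+1]}) (B : 'M[K]_n),
          G^`M(ord0) = 0 /\ skew_zero_diag B /\ \det B != 0 /\
          lin_subst M F = 'X_ord0 * G + frob_form_tail q B)) /\
  (* (3) *)
  (d = (q + 2)%N <->
     (p = 2%N /\ n = 2%N /\
      exists (c : K) (G : {mpoly K[n.+1]}), c != 0 /\
        c *: F = 'X_(inord 0) * 'X_(inord 1) * 'X_(inord 2) *
                   ('X_(inord 0) ^+ (q - 1) + 'X_(inord 1) ^+ (q - 1)
                    + 'X_(inord 2) ^+ (q - 1))
                 + sq_subst G)) /\
  (* final claim *)
  (((d = q.+1 /\ odd n) \/ d = (q + 2)%N) <-> frob10 q F = 0).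
Proof.
subst q; case: n hn F hF0 hFd hsmooth hnc => [|[|m]] // _ F hF0 hFd hsmooth hnc.
have d_gt0 : (0 < d)%N := ltnW hd.
have [H hH eH] := frob10_quotient_homog d_gt0 hFd hnc.
have d_bound : d%:R != 0 :> K -> (d <= #|K|.+1)%N.
  by move=> d0; exact: (nonclassical_bound hFd hsmooth d0 hH eH).
have d_add2 := degree_add2 hchar hFd hsmooth eH.
have succ_neq0 : #|K|.+1%:R != 0 :> K by rewrite (succ_card_natr hchar) oner_eq0.
have d_case : (d <= #|K|.+1)%N \/ d%:R = 0 :> K /\ (#|K|.+2 <= d)%N.
  by case: leqP => // lt_d; [left|right; split=> //; apply/eqP; apply: contraLR lt_d; rewrite -leqNgt].
have dich : d = #|K|.+1 -> _ := fun e => degree_succ_dichotomy hchar (n := m.+2) isT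
  (eq_ind d (fun k => F \is k.-homog) hFd _ e) hsmooth hH eH.
have d_case3 : d = (#|K| + 2)%N -> d%:R = 0 :> K /\ (#|K|.+2 <= d)%N.
  by rewrite addn2; case: d_case => [le_d|//] e; rewrite e ltnn in le_d.
split; first by rewrite addn2; case: d_case => [/leqW|[d0 /(d_add2 d0) [-> _]]].
have part1 : (d = #|K|.+1 /\ odd m.+2) <-> exists A : 'M[K]_(m.+3),
    skew_zero_diag A /\ \det A != 0 /\ F = frob_form #|K| A.
  split=> [[/dich [[_ [A [hA dA FA]]]|[/negPf -> //]] _]|[A [hA [dA FA]]]].
    by exists A.
  split; first by apply: dhomog_uniq hF0 hFd _; rewrite FA; apply: frob_form_homog.
  by apply: contraNT dA => ev; rewrite det_skew_odd // oddS.
have part3 : d = (#|K| + 2)%N -> frob10 #|K| F = 0.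
  by move=> /d_case3 [d0 le_d]; have [_ [_ [_ []]]] := d_add2 d0 le_d.
split; first exact: part1.
split; [|split].
- split=> [[/dich [[-> //]|[_ p2 [M uM [eM [G [B [G0 hB dB FE]]]]]]] _]|].
    by split=> //; exists M; rewrite subn1; do 2!split=> //; exists G, B.
  case=> _ [M [uM [_ [G [B [_ [hB [dB FE]]]]]]]]; split.
    by apply: (@tail_degree K m.+1 d G B) => //; rewrite -FE lin_subst_homog.
  by apply: contraNN dB => ev; rewrite det_skew_odd.
- split=> [/d_case3 [d0 le_d]|[p2 [[m0] [c [G [c0 cF]]]]]].
    have [_ [p2 [m0 [_ form]]]] := d_add2 d0 le_d.
    by split; [exact: p2|split; [rewrite m0|exact: form]].
  rewrite addn2; subst m; apply: (ternary_degree hchar d_gt0 hFd _ cF).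
  by have := pcharf0 hchar; rewrite p2.
- split=> [[/part1 [A [hA [_ ->]]]|/part3 //]|f0].
    exact: (frob10_frob_form hchar).
  have lt_d := frob10_eq0_degree d_gt0 hF0 hFd hsmooth f0.
  case: d_case => [le_d|[d0 /(d_add2 d0) [-> _]]]; last by right; rewrite addn2.
  have dE : d = #|K|.+1 by apply/eqP; rewrite eqn_leq le_d.
  case: (dich dE) => [[ev _]|[_ _ [M uM [eM _]]]]; first by left.
  move: eM; rewrite (frob10_lin_subst hchar) f0 rmorph0 => /esym/eqP.
  rewrite mulf_eq0 mpolyXn mpolyX_eq0 /= => /eqP FM0; case/eqP: hF0.
  by rewrite -(lin_subst1 F) -(mulmxV uM) -lin_subst_comp FM0 rmorph0.
Qed.
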